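(* Let $n\ge 2$. (a) If $\mathcal{E}_{gh}=0$ in $\overline{\mathcal{T}}_n$, then $\overline{\mathcal{T}}_n$ is commutative with a PBW basis $\{h^{n_2}g^{n_1}\mid 0\le n_1\le n-1,\ n_2\in\mathbb{N}\}$. (b) If $\mathcal{E}_{gh}\ne 0$ in $\overline{\mathcal{T}}_n$, $\operatorname{char}\mathbb{K}=p>0$ and $p\mid n$, then $\overline{\mathcal{T}}_n$ has infinite GK-dimension, with a PBW basis $$\{h^{n_2}\mathcal{E}_{\omega_{k_1}}^{n_{\omega_{k_1}}}\mathcal{E}_{\omega_{k_2}}^{n_{\omega_{k_2}}}\cdots\mathcal{E}_{\omega_{k_m}}^{n_{\omega_{k_m}}}g^{n_1}\mid k_1>k_2>\cdots>k_m\ge 1,\ 0\le n_1\le n-1,\ n_2,n_{\omega_{k_i}}\in\mathbb{N},\ 1\le i\le m\}.$$ Furthermore, the antipode $S$ of $\overline{\mathcal{T}}_n$ satisfies $S^{2p}=\mathrm{id}$.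
   Context: $\mathbb{K}$ is a field, $\mathbb{N}=\{0,1,2,\ldots\}$, and $[a,b]=ab-ba$. On words in the letters $g,h$ use the lexicographic order with $g\prec h$ (a proper prefix of a word is smaller than the word). A Lyndon word is a nonempty word $\alpha$ which is a single letter or satisfies $\alpha\prec\gamma\beta$ for every factorization $\alpha=\beta\gamma$ into nonempty words. $\alpha(g)$ is the number of occurrences of $g$ in $\alpha$. The standard factorization of a Lyndon word $\alpha$ of length at least $2$ is $\alpha=\beta\gamma$ with $\beta,\gamma$ Lyndon and $\gamma$ of maximal length. Define $E_g=g$, $E_h=h$ and $E_\alpha=[E_\beta,E_\gamma]$ for the standard factorization $\alpha=\beta\gamma$. $\mathcal{T}=\mathbb{K}\langle g,h\rangle$ is the free algebra with bialgebra structure $\Delta(g)=g\otimes g$, $\Delta(h)=1\otimes h+h\otimes g$, $\epsilon(g)=1$, $\epsilon(h)=0$. $\overline{\mathcal{T}}=\mathcal{T}/\mathcal{I}$ is the quotient bialgebra by the ideal generated by all $E_\alpha$ with $\alpha$ Lyndon and $\alpha(g)\ge 2$. $\overline{\mathcal{T}}_n=\overline{\mathcal{T}}/(g^n-1)$, a quotient bialgebra of $\overline{\mathcal{T}}$ which is a Hopf algebra. For $k\ge 0$, $\omega_k=gh^k$, so $E_{\omega_0}=g$, $E_{\omega_1}=E_{gh}=[g,h]$, $E_{\omega_k}=[E_{\omega_{k-1}},h]$. In $\overline{\mathcal{T}}_n$ write $g,h,\mathcal{E}_{\omega_k}$ for the images of $g,h,E_{\omega_k}$, and $\mathcal{E}_{gh}=\mathcal{E}_{\omega_1}$.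 A PBW basis means that the displayed ordered monomials form a $\mathbb{K}$-vector space basis. GK-dimension is Gelfand–Kirillov dimension. *)

(* Defs.v *)
From HB Require Import structures.
From mathcomp Require Import all_boot all_order all_algebra finmap.
(* monalg must be imported before mathcomp-analysis: in the other order their
   notations clash. *)
From mathcomp Require Import monalg.
From mathcomp Require Import all_classical all_reals all_analysis.
From mathcomp Require Import zify.

Set Implicit Arguments.
Unset Strict Implicit.
Unset Printing Implicit Defensive.

Import Order.TTheory GRing.Theory Num.Theory.
Local Open Scope quotient_scope.
Local Open Scope ring_scope.

(* The two-sided ideal generated by G, as the set of finite sums of a * g * b
   with g in G. *)
Inductive ideal_gen (A : nzRingType) (G : A -> Prop) : A -> Prop :=
| ideal_gen0 : ideal_gen G 0
| ideal_genMD a g b x : G g -> ideal_gen G x -> ideal_gen G (a * g * b + x).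

Definition ideal_pred (A : nzRingType) (G : A -> Prop) : {pred A} :=
  fun x => `[< ideal_gen G x >].

Section IdealTheory.
Variables (A : nzRingType) (G : A -> Prop).

Lemma ideal_predP x : reflect (ideal_gen G x) (x \in ideal_pred G).
Proof. exact: asboolP. Qed.

Lemma ideal_genD x y : ideal_gen G x -> ideal_gen G y -> ideal_gen G (x + y).
Proof.
by elim=> [|a g b z Gg _ IH] hy; rewrite ?add0r // -addrA; apply: ideal_genMD => //; apply: IH.
Qed.

Lemma ideal_genMl c x : ideal_gen G x -> ideal_gen G (c * x).
Proof.
elim=> [|a g b z Gg _ IH]; first by rewrite mulr0; apply: ideal_gen0.
by rewrite mulrDr !mulrA; apply: ideal_genMD.
Qed.

Lemma ideal_genMr c x : ideal_gen G x -> ideal_gen G (x * c).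
Proof.
elim=> [|a g b z Gg _ IH]; first by rewrite mul0r; apply: ideal_gen0.
by rewrite mulrDl -mulrA; apply: ideal_genMD.
Qed.

Lemma ideal_genN x : ideal_gen G x -> ideal_gen G (- x).
Proof. by move=> hx; rewrite -mulN1r; apply: ideal_genMl. Qed.

Lemma ideal_gen_generator g : G g -> ideal_gen G g.
Proof.
move=> Gg; rewrite -[g]addr0 -[X in X + _]mul1r -[X in X + _]mulr1.
by apply: ideal_genMD => //; apply: ideal_gen0.
Qed.

Fact ideal_pred_zmod_closed : zmod_closed (ideal_pred G).
Proof.
split=> [|x y /ideal_predP hx /ideal_predP hy]; apply/ideal_predP.
  exact: ideal_gen0.
by apply: ideal_genD => //; apply: ideal_genN.
Qed.
HB.instance Definition _ :=
  GRing.isZmodClosed.Build A (ideal_pred G) ideal_pred_zmod_closed.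

Lemma ideal_gen_proper (B : nzRingType) (f : {rmorphism A -> B}) :
  (forall g, G g -> f g = 0) -> ~ ideal_gen G 1.
Proof.
move=> fG h1; suff /eqP : f 1 = 0 by rewrite rmorph1 oner_eq0.
elim: h1 => [|a g b x Gg _ IH]; first exact: rmorph0.
by rewrite rmorphD !rmorphM IH (fG _ Gg) mulr0 mul0r addr0.
Qed.

End IdealTheory.

(* A / (G).  An lalgType is a nontrivial ring, whence the proof argument. *)
Definition quot_alg (K : pzRingType) (A : lalgType K) (G : A -> Prop)
  (Gproper : ~ ideal_gen G 1) : Type := {ideal_quot (ideal_pred G)}.

Section QuotAlg.
Variables (K : pzRingType) (A : lalgType K) (G : A -> Prop).
Variable Gproper : ~ ideal_gen G 1.

Local Notation Q := (quot_alg Gproper).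
HB.instance Definition _ := Choice.on Q.
HB.instance Definition _ := GRing.Zmodule.on Q.
HB.instance Definition _ : EqQuotient A (Quotient.equiv (ideal_pred G)) Q :=
  EqQuotient.on Q.
HB.instance Definition _ := ZmodQuotient.on Q.

Lemma quot_eqP (x y : A) : reflect (ideal_gen G (x - y)) (x == y %[mod Q]).
Proof. by rewrite -(Quotient.idealrBE (ideal_pred G)); apply: ideal_predP. Qed.

Lemma quot_eq (x y : A) : ideal_gen G (x - y) -> \pi_Q x = \pi_Q y.
Proof. by move=> h; apply/eqP/quot_eqP. Qed.

Lemma quot_reprP (x : A) : ideal_gen G (repr (\pi_Q x) - x).
Proof. by apply/quot_eqP; rewrite reprK. Qed.

Definition quot_one : Q := \pi_Q 1.
Definition quot_mul (x y : Q) : Q := \pi_Q (repr x * repr y).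
Definition quot_scale (c : K) (x : Q) : Q := \pi_Q (c *: repr x).

Lemma pi_quot_mul (x y : A) : \pi_Q (x * y) = quot_mul (\pi_Q x) (\pi_Q y).
Proof.
apply/esym/quot_eq; set a := repr _; set b := repr _.
have -> : a * b - x * y = (a - x) * b + x * (b - y).
  by rewrite mulrBl mulrBr addrA subrK.
apply: ideal_genD; [apply: ideal_genMr|apply: ideal_genMl]; exact: quot_reprP.
Qed.

Lemma pi_quot_scale (c : K) (x : A) : \pi_Q (c *: x) = quot_scale c (\pi_Q x).
Proof.
apply/esym/quot_eq; set a := repr _.
rewrite -scalerBr -[a - x]mul1r scalerAl.
by apply: ideal_genMl; apply: quot_reprP.
Qed.

Lemma pi_quot_add (x y : A) : \pi_Q (x + y) = \pi_Q x + \pi_Q y.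
Proof. exact: (raddfD (\pi_{ideal_quot (ideal_pred G)} : {additive _ -> _})). Qed.

Lemma quot_ind (P : Q -> Prop) : (forall x, P (\pi_Q x)) -> forall x, P x.
Proof. by move=> h x; rewrite -[x]reprK. Qed.

Fact quot_mulA : associative quot_mul.
Proof.
by do 3![elim/quot_ind=> ?]; rewrite -!pi_quot_mul mulrA.
Qed.
Fact quot_mul1 : left_id quot_one quot_mul.
Proof. by elim/quot_ind=> x; rewrite -pi_quot_mul mul1r. Qed.
Fact quot_mulr1 : right_id quot_one quot_mul.
Proof. by elim/quot_ind=> x; rewrite -pi_quot_mul mulr1. Qed.
Fact quot_mulDl : left_distributive quot_mul +%R.
Proof.
by do 3![elim/quot_ind=> ?]; rewrite -!(pi_quot_mul, pi_quot_add) mulrDl.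
Qed.
Fact quot_mulDr : right_distributive quot_mul +%R.
Proof.
by do 3![elim/quot_ind=> ?]; rewrite -!(pi_quot_mul, pi_quot_add) mulrDr.
Qed.
Fact quot_one_neq0 : quot_one != 0.
Proof.
apply/negP => /eqP h; apply: Gproper.
have /quot_eqP : \pi_Q 1 == \pi_Q 0.
  apply/eqP; rewrite -/quot_one h; apply: esym.
  exact: (raddf0 (\pi_{ideal_quot (ideal_pred G)} : {additive _ -> _})).
by rewrite subr0.
Qed.
HB.instance Definition _ := GRing.Zmodule_isNzRing.Build Q
  quot_mulA quot_mul1 quot_mulr1 quot_mulDl quot_mulDr quot_one_neq0.

Fact quot_scaleA (a b : K) (x : Q) :
  quot_scale a (quot_scale b x) = quot_scale (a * b) x.
Proof. by elim/quot_ind: x => x; rewrite -!pi_quot_scale scalerA. Qed.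
Fact quot_scale1 : left_id 1 quot_scale.
Proof. by elim/quot_ind=> x; rewrite -pi_quot_scale scale1r. Qed.
Fact quot_scaleDr : right_distributive quot_scale +%R.
Proof.
by move=> c; do 2![elim/quot_ind=> ?]; rewrite -!(pi_quot_scale, pi_quot_add) scalerDr.
Qed.
Fact quot_scaleDl (x : Q) : {morph quot_scale^~ x : a b / a + b}.
Proof.
by elim/quot_ind: x => x a b; rewrite -!(pi_quot_scale, pi_quot_add) scalerDl.
Qed.
HB.instance Definition _ := GRing.Zmodule_isLmodule.Build K Q
  quot_scaleA quot_scale1 quot_scaleDr quot_scaleDl.

Fact quot_scaleAl (c : K) (x y : Q) : c *: (x * y) = c *: x * y.
Proof.
elim/quot_ind: x => x; elim/quot_ind: y => y.
rewrite -[LHS]/(quot_scale c (quot_mul (\pi_Q x) (\pi_Q y))).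
rewrite -[RHS]/(quot_mul (quot_scale c (\pi_Q x)) (\pi_Q y)).
by rewrite -pi_quot_mul -!pi_quot_scale -pi_quot_mul scalerAl.
Qed.
HB.instance Definition _ := GRing.Lmodule_isLalgebra.Build K Q quot_scaleAl.

Definition quot_pi (x : A) : Q := \pi_Q x.

Fact quot_pi_linear : linear quot_pi.
Proof. by move=> c x y; rewrite /quot_pi pi_quot_add pi_quot_scale. Qed.
Fact quot_pi_monoid : monoid_morphism quot_pi.
Proof. by split=> [|x y] //; apply: pi_quot_mul. Qed.
HB.instance Definition _ := GRing.isLinear.Build K A Q _ quot_pi quot_pi_linear.
HB.instance Definition _ := GRing.isMonoidMorphism.Build A Q quot_pi quot_pi_monoid.

Lemma quot_piP (x : A) : quot_pi x = 0 <-> ideal_gen G x.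
Proof.
rewrite -(rmorph0 quot_pi); split=> [/eqP/quot_eqP|h]; first by rewrite subr0.
by apply: quot_eq; rewrite subr0.
Qed.

Lemma quot_pi_surj (y : Q) : exists x, quot_pi x = y.
Proof. by exists (repr y); rewrite /quot_pi reprK. Qed.

Section Lift.
Variables (B : nzRingType) (f : {rmorphism A -> B}).

Definition quot_lift of (forall g, G g -> f g = 0) : Q -> B :=
  fun x => f (repr x).

Hypothesis fG : forall g, G g -> f g = 0.

Lemma quot_liftE x : quot_lift fG (quot_pi x) = f x.
Proof.
apply/eqP; rewrite /quot_lift -subr_eq0 -rmorphB; apply/eqP.
elim: (quot_reprP x) => [|a g b z Gg _ IH]; first exact: rmorph0.
by rewrite rmorphD !rmorphM IH (fG Gg) mulr0 mul0r addr0.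
Qed.

Fact quot_lift_zmod : zmod_morphism (quot_lift fG).
Proof.
move=> x y; have [a <-] := quot_pi_surj x; have [b <-] := quot_pi_surj y.
by rewrite -rmorphB !quot_liftE rmorphB.
Qed.
Fact quot_lift_monoid : monoid_morphism (quot_lift fG).
Proof.
split=> [|x y]; first by rewrite -(rmorph1 quot_pi) quot_liftE rmorph1.
have [a <-] := quot_pi_surj x; have [b <-] := quot_pi_surj y.
by rewrite -rmorphM !quot_liftE rmorphM.
Qed.
HB.instance Definition _ :=
  GRing.isZmodMorphism.Build Q B (quot_lift fG) quot_lift_zmod.
HB.instance Definition _ :=
  GRing.isMonoidMorphism.Build Q B (quot_lift fG) quot_lift_monoid.
End Lift.

End QuotAlg.

(* false is the letter g and true is the letter h, so that g < h. *)
Definition word := seq bool.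
Definition lg : bool := false.
Definition lh : bool := true.

Definition word_lt (u v : word) : bool := ((u : seqlexi bool) < v)%O.

Definition lyndon (w : word) : bool :=
  (w != [::]) &&
  [forall i : 'I_(size w), (0 < i)%N ==> word_lt w (drop i w ++ take i w)].

(* The least i such that w = (take i w)(drop i w) with both factors Lyndon (in
   particular nonempty); the right factor then has maximal length. *)
Definition std_cut (w : word) : nat :=
  find (fun i => lyndon (take i w) && lyndon (drop i w)) (iota 0 (size w)).

Definition omega (k : nat) : word := lg :: nseq k lh.

Lemma lyndon_hs k : lyndon (nseq k lh) = (k == 1%N).
Proof.
rewrite /lyndon; case: k => [|[|k]] //=.
  by apply/forallP => -[[|i] hi].
apply/negbTE/forallPn; have h : (1 < size (nseq k.+2 lh))%N by rewrite size_nseq.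
exists (Ordinal h); rewrite negb_imply /=.
rewrite cats1.
have -> : rcons (nseq k lh) lh = lh :: nseq k lh.
  by elim: k {h} => //= k ->.
by rewrite /word_lt ltxx.
Qed.

Lemma lyndon_omega k : lyndon (omega k).
Proof.
apply/andP; split=> //; apply/forallP => -[[|i] hi] //=.
rewrite drop_nseq.
have : (i < k)%N by move: hi; rewrite /omega /= size_nseq.
by case: (k - i)%N (subn_gt0 i k) => [|j] <-.
Qed.

Lemma std_cut_omega k : std_cut (omega k.+1) = k.+1.
Proof.
rewrite /std_cut; have -> : size (omega k.+1) = k.+2 by rewrite /= size_nseq.
set P := fun _ => _.
have Pk : P k.+1.
  have -> : P k.+1 = lyndon (lg :: take k (nseq k.+1 lh)) && lyndon (drop k (nseq k.+1 lh)) by [].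
  rewrite take_nseq // drop_nseq subSnn lyndon_hs eqxx andbT.
  exact: lyndon_omega.
have nP i : (i <= k)%N -> ~~ P i.
  case: i => [|i] hi; rewrite /P //.
  rewrite -[drop i.+1 _]/(drop i (nseq k.+1 lh)) drop_nseq lyndon_hs negb_and.
  by apply/orP; right; lia.
have -> : iota 0 k.+2 = iota 0 k.+1 ++ [:: k.+1].
  by rewrite -[in LHS]addn1 iotaD.
rewrite find_cat.
have -> : has P (iota 0 k.+1) = false.
  by apply/negbTE/hasPn => i; rewrite mem_iota => hi; apply: nP; lia.
by rewrite -[find P [:: _]]/(if P k.+1 then 0%N else 1%N) Pk size_iota addn0.
Qed.

Definition FA (K : fieldType) : Type := {malg K[{fmonom bool}]}.
HB.instance Definition _ (K : fieldType) :=
  GRing.Lalgebra.copy (FA K) {malg K[{fmonom bool}]}.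

Definition letter (K : fieldType) (a : bool) : FA K := << fmu a >>.

Definition bracket (A : pzRingType) (x y : A) : A := x * y - y * x.

(* m bounds the length of the word; the values at words which are not Lyndon are
   irrelevant. *)
Fixpoint E_rec (K : fieldType) (m : nat) (w : word) : FA K :=
  match m, w with
  | _, [:: a] => letter K a
  | m'.+1, _ => bracket (E_rec K m' (take (std_cut w) w))
                        (E_rec K m' (drop (std_cut w) w))
  | _, _ => 0
  end.
Definition E (K : fieldType) (w : word) : FA K := E_rec K (size w) w.

Lemma E_omega0 (K : fieldType) : E K (omega 0) = letter K lg.
Proof. by []. Qed.

Lemma E_recS (K : fieldType) m a b w : E_rec K m.+1 [:: a, b & w] =
  bracket (E_rec K m (take (std_cut [:: a, b & w]) [:: a, b & w]))
          (E_rec K m (drop (std_cut [:: a, b & w]) [:: a, b & w])).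
Proof. by []. Qed.

Lemma E_rec1 (K : fieldType) m a : E_rec K m [:: a] = letter K a.
Proof. by case: m. Qed.

Lemma E_omegaS (K : fieldType) k :
  E K (omega k.+1) = bracket (E K (omega k)) (letter K lh).
Proof.
have sz j : size (omega j) = j.+1 by rewrite /= size_nseq.
rewrite /E !sz {1}/omega E_recS -[[:: lg, lh & nseq k lh]]/(omega k.+1).
rewrite std_cut_omega.
have -> : take k.+1 (omega k.+1) = omega k.
  by rewrite -[LHS]/(lg :: take k (nseq k.+1 lh)) take_nseq.
have -> : drop k.+1 (omega k.+1) = [:: lh].
  by rewrite -[LHS]/(drop k (nseq k.+1 lh)) drop_nseq subSnn.
by rewrite E_rec1.
Qed.

Definition counit_letter (K : fieldType) (a : bool) : K := (a == lg)%:R.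
Definition counit_word (K : fieldType) (w : {fmonom bool}) : K :=
  \prod_(a <- (w : seq bool)) counit_letter K a.
Definition counit (K : fieldType) : FA K -> K := mmap idfun (counit_word K).

(* T (x) T is the monoid algebra of pairs of words, (u, v) standing for
   u (x) v. *)
Section ProdMonom.
Variables M N : monomType.
Definition pair_one : M * N := (mone, mone).
Definition pair_mul (x y : M * N) : M * N := (mmul x.1 y.1, mmul x.2 y.2).
Fact pair_mulA : associative pair_mul.
Proof. by move=> [? ?] [? ?] [? ?]; rewrite /pair_mul /= !mulmA. Qed.
Fact pair_mul1m : left_id pair_one pair_mul.
Proof. by move=> [? ?]; rewrite /pair_mul /= !mul1m. Qed.
Fact pair_mulm1 : right_id pair_one pair_mul.
Proof. by move=> [? ?]; rewrite /pair_mul /= !mulm1. Qed.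
Fact pair_unitm x y : pair_mul x y = pair_one -> x = pair_one /\ y = pair_one.
Proof.
by case: x y => [a b] [c d] [] /unitm[-> ->] /unitm[-> ->].
Qed.
HB.instance Definition _ := Choice_isMonomialDef.Build (M * N)%type
  pair_mulA pair_mul1m pair_mulm1 pair_unitm.
End ProdMonom.

Definition FA2 (K : fieldType) : Type :=
  {malg K[({fmonom bool} * {fmonom bool})%type]}.
HB.instance Definition _ (K : fieldType) := GRing.Lalgebra.copy (FA2 K)
  {malg K[({fmonom bool} * {fmonom bool})%type]}.

Definition tens (K : fieldType) (x y : FA K) : FA2 K :=
  \sum_(u <- msupp x) \sum_(v <- msupp y) << x@_u * y@_v *g (u, v) >>.

Definition coprod_letter (K : fieldType) (a : bool) : FA2 K :=
  let g := letter K lg in let h := letter K lh in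
  if a == lg then tens g g else tens 1 h + tens h g.

Definition coprod (K : fieldType) (x : FA K) : FA2 K :=
  \sum_(w <- msupp x) x@_w *: \prod_(a <- (w : seq bool)) coprod_letter K a.

Section Counit.
Variable K : fieldType.
Fact counit_word_mmorphism : mmorphism (counit_word K).
Proof.
split=> [x y|]; last by rewrite /counit_word fm1 big_nil.
by rewrite /counit_word fmM big_cat.
Qed.
HB.instance Definition _ :=
  isMultiplicative.Build _ K (counit_word K) counit_word_mmorphism.
HB.instance Definition _ := GRing.RMorphism.copy (@counit K)
  (mmap (idfun : {rmorphism K -> K}) (counit_word K : {mmorphism _ -> K})).

Lemma counit_letterE a : counit (letter K a) = counit_letter K a.
Proof.
by rewrite /counit /letter mmapU /= mul1r /counit_word fmU big_seq1.
Qed.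
End Counit.

Section Quotients.
Variable K : fieldType.

Definition gens_I (x : FA K) : Prop :=
  exists w : word, [/\ lyndon w, (2 <= count_mem lg w)%N & x = E K w].

Lemma counit_gens_I x : gens_I x -> counit x = 0.
Proof.
have br0 (a b : FA K) : counit (bracket a b) = 0.
  by rewrite /bracket rmorphB !rmorphM mulrC subrr.
case=> -[|a [|b w]] [//= _ c2 ->]; first by case: a c2.
exact: br0.
Qed.

Lemma gens_I_proper : ~ ideal_gen gens_I 1.
Proof. exact: (ideal_gen_proper counit_gens_I). Qed.

Definition Tbar : Type := quot_alg gens_I_proper.
HB.instance Definition _ := GRing.Lalgebra.on Tbar.

Definition pi_bar (x : FA K) : Tbar := quot_pi gens_I_proper x.
HB.instance Definition _ := GRing.LRMorphism.copy pi_bar (quot_pi gens_I_proper).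

Definition counit_bar (x : Tbar) : K :=
  quot_lift (Gproper := gens_I_proper) counit_gens_I x.
HB.instance Definition _ := GRing.RMorphism.copy counit_bar
  (quot_lift (Gproper := gens_I_proper) counit_gens_I).

Variable n : nat.

Definition gens_n (x : Tbar) : Prop := x = pi_bar (letter K lg) ^+ n - 1.

Lemma counit_gens_n x : gens_n x -> counit_bar x = 0.
Proof.
have e : counit_bar (pi_bar (letter K lg)) = 1.
  have := @quot_liftE _ _ _ gens_I_proper _ (@counit K) counit_gens_I (letter K lg).
  by move=> h; apply: etrans h _; apply: counit_letterE.
by move=> ->; rewrite rmorphB rmorphXn rmorph1 /= e expr1n subrr.
Qed.

Lemma gens_n_proper : ~ ideal_gen gens_n 1.
Proof. exact: (ideal_gen_proper counit_gens_n). Qed.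

Definition Tn : Type := quot_alg gens_n_proper.
HB.instance Definition _ := GRing.Lalgebra.on Tn.

Definition pi_n (x : FA K) : Tn := quot_pi gens_n_proper (pi_bar x).
HB.instance Definition _ := GRing.LRMorphism.copy pi_n
  (quot_pi gens_n_proper \o pi_bar).

Definition gn : Tn := pi_n (letter K lg).
Definition hn : Tn := pi_n (letter K lh).
Definition En (k : nat) : Tn := pi_n (E K (omega k)).

(* m o (S (x) S') o (pi_n (x) pi_n) on T (x) T, where m is multiplication. *)
Definition conv2 (S S' : Tn -> Tn) (z : FA2 K) : Tn :=
  \sum_(uv <- msupp z) z@_uv *: (S (pi_n << uv.1 >>) * S' (pi_n << uv.2 >>)).

(* The antipode is the convolution inverse of the identity.  The coproduct and
   the counit of a quotient bialgebra are induced by those of T, so that the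
   convolution product S * S' on Tn, evaluated at the class of x, is
   conv2 S S' (coprod x). *)
Definition is_antipode (S : {linear Tn -> Tn}) : Prop :=
  forall x : FA K,
    conv2 S idfun (coprod x) = (counit x)%:A /\
    conv2 idfun S (coprod x) = (counit x)%:A.

(* s lists pairs (k_i, n_i) and stands for the product of the E_{omega_k_i}^n_i,
   in that order. *)
Definition mon_E (s : seq (nat * nat)) : Tn := \prod_(q <- s) En q.1 ^+ q.2.

Definition mon (i : nat * seq (nat * nat) * nat) : Tn :=
  hn ^+ i.1.1 * mon_E i.1.2 * gn ^+ i.2.

(* Factors with exponent zero are omitted from s, so that every monomial is
   listed exactly once: allowing n_i = 0 does not give any further monomial. *)
Definition mon_index : pred (nat * seq (nat * nat) * nat) := fun i =>
  [&& sorted gtn [seq q.1 | q <- i.1.2],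
      all (fun q => (1 <= q.1)%N && (1 <= q.2)%N) i.1.2 & (i.2 < n)%N].

End Quotients.

Section LinearAlgebra.
Variables (K : fieldType) (V : lmodType K).

Definition lin_indep (I : eqType) (P : pred I) (F : I -> V) : Prop :=
  forall (s : seq I) (c : I -> K), uniq s -> all P s ->
    \sum_(i <- s) c i *: F i = 0 -> forall i, i \in s -> c i = 0.

Definition spanning (I : eqType) (P : pred I) (F : I -> V) : Prop :=
  forall x : V, exists (s : seq I) (c : I -> K),
    all P s /\ x = \sum_(i <- s) c i *: F i.

Definition is_basis (I : eqType) (P : pred I) (F : I -> V) : Prop :=
  lin_indep P F /\ spanning P F.

Definition span_dim (s : seq V) : nat :=
  \max_(J : {set 'I_(size s)} |
        `[< lin_indep (mem J) (fun i : 'I_(size s) => s`_i) >]) #|J|.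

End LinearAlgebra.

(* All products of at most m elements of s. *)
Fixpoint products (A : nzRingType) (s : seq A) (m : nat) : seq A :=
  if m is m'.+1 then 1 :: [seq x * y | x <- s, y <- products s m'] else [:: 1].

(* sup over the finite-dimensional subspaces V = span s of
   limsup_m log_m dim (K + V + V^2 + ... + V^m). *)
Definition GKdim (R : realType) (K : fieldType) (A : lalgType K) : \bar R :=
  ereal_sup (range (fun s : seq A =>
    limn_esup (fun m : nat =>
      (ln (span_dim (products s m))%:R / ln m%:R)%:E))).

(* Main.v *)
Require Import Defs.
From HB Require Import structures.
From mathcomp Require Import all_boot all_order all_algebra finmap.
From mathcomp Require Import monalg.
From mathcomp Require Import all_classical all_reals all_analysis.
From mathcomp Require Import zify.

(** Write [x_k] for [E_(omega_k)], so that [x_0 = g] and [[x_k, h] = x_(k+1)].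
    A Lyndon word with two letters [g] or more is cut by its standard
    factorization until both factors have exactly one letter [g], that is, are of
    the form [g h^a] and [g h^b].  The ideal defining [Tbar] is therefore generated
    by the commutators of the [x_k] ([gens_I_comm], [comm_gens_I]), and [Tbar] is
    the Ore extension [K[x_0, x_1, ...][h; d]], where [d x_k = x_(k+1)].  The
    algebra [Tn] adds the relation [x_0^n = 1].

    Spanning.  The [x_k] generate a commutative subalgebra [Ealg] which is stable
    under [[-, h]]; so words in [g] and [h] can be rewritten as sums of [h^i c] with
    [c] in [Ealg], and [c] as a combination of ordered monomials ([mon_spanning]).

    Independence.  [Tn] acts on the right of [K[x_0, x_1, ...] / (x_0^n - 1)]: [g]
    multiplies by [x_0] and [h] applies [d].  This is compatible with the quotient
    when [n = 0] in [K], since then [d (x_0^n - 1) = n x_0^(n-1) x_1 = 0].  The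
    monomial [h^i c] maps [x_m] to [x_(m+i) c], and for [m] large these are
    distinct reduced monomials ([mon_indep]).  If [h] multiplies by [x_1] instead,
    the [x_k] with [k >= 1] act by zero and one gets a module in every
    characteristic, on which the [h^i g^j] are independent ([hg_indep]); this
    gives the basis when [x_1 = 0], where [Tn] is generated by two commuting
    elements.

    Growth.  [x_1, ..., x_N] generate a polynomial ring in [N] variables, for every
    [N], so that the growth of [Tn] has no polynomial bound ([Tn_GKdim]).

    Antipode.  The antimorphism with [S g = g^-1] and [S h = - h g^-1] sends every
    [x_k] into [Ealg], hence kills the relations; the two convolution identities
    are checked letter by letter.  A right convolution inverse of the identity is
    unique because [Delta w = g^a (x) w + ...], where the omitted terms have fewer
    letters [h] on the right ([conv_right_inj]).  Finally [S^2] is conjugation by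
    [g], and [g^p] is central since [[g^p, h] = p g^(p-1) x_1 = 0]
    ([antipode_order]). *)

Set Implicit Arguments.
Unset Strict Implicit.
Unset Printing Implicit Defensive.

Import Order.TTheory GRing.Theory Num.Theory.
Local Open Scope ring_scope.

(** * Linear extension and the free algebra *)

Section LinearExtension.
Variables (K : fieldType) (X : choiceType) (V : lmodType K) (F : X -> V).

Definition linext (z : {malg K[X]}) : V := \sum_(k <- msupp z) z@_k *: F k.

Lemma linextEw (d : {fset X}) z : (msupp z `<=` d)%fset ->
  linext z = \sum_(k <- d) z@_k *: F k.
Proof.
move=> le; rewrite /linext; apply: big_fset_incl => //= x xd /mcoeff_outdom ->.
by rewrite scale0r.
Qed.

Lemma linextU c k : linext << c *g k >> = c *: F k.
Proof. by rewrite (linextEw msuppU_le) big_seq_fset1 mcoeffUU. Qed.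

Lemma linext_is_linear : linear linext.
Proof.
move=> c x y; pose d := (msupp x `|` msupp y `|` msupp (c *: x + y))%fset.
rewrite (@linextEw d x) ?(@linextEw d y) ?(@linextEw d (_ + _)) /d; first last.
- by apply/fsubsetP => k; rewrite !inE => ->; rewrite ?orbT.
- by apply/fsubsetP => k; rewrite !inE => ->; rewrite ?orbT.
- by apply/fsubsetP => k; rewrite !inE => ->; rewrite ?orbT.
rewrite scaler_sumr -big_split /=; apply: eq_bigr => k _.
by rewrite mcoeffD mcoeffZ scalerDl scalerA.
Qed.
HB.instance Definition _ :=
  GRing.isLinear.Build K {malg K[X]} V _ linext linext_is_linear.
End LinearExtension.

Lemma malg_lin_ind (K : fieldType) (X : choiceType) (P : {malg K[X]} -> Prop) :
  P 0 -> (forall c k x, P x -> P (c *: << k >> + x)) -> forall x, P x.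
Proof.
move=> P0 PD x; rewrite (monalgE x); elim: (X in \sum_(k <- X) _) => [|k s IH].
  by rewrite big_nil.
rewrite big_cons; have -> : << x@_k *g k >> = x@_k *: << k >>.
  by apply/eqP/eqP/malgP => l; rewrite mcoeffZ !mcoeffU mulrnAr mulr1.
exact: PD.
Qed.

Lemma linear_at0 (K : fieldType) (V W : lmodType K) (f : V -> W) :
  linear f -> f 0 = 0.
Proof. by move=> fL; have := fL (-1) 0 0; rewrite scaler0 addr0 scaleN1r addNr. Qed.

Lemma malg_lin_ext (K : fieldType) (X : choiceType) (V : lmodType K)
    (f1 f2 : {malg K[X]} -> V) :
  linear f1 -> linear f2 -> (forall k, f1 << k >> = f2 << k >>) -> f1 =1 f2.
Proof.
move=> l1 l2 e; elim/malg_lin_ind=> [|c s x IH]; first by rewrite !linear_at0.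
by rewrite l1 l2 e IH.
Qed.

Lemma malgUM (K : fieldType) (M : monomType) (u v : M) :
  << u >> * << v >> = << mmul u v >> :> {malg K[M]}.
Proof. by rewrite malgM_def fgmulUU mulr1. Qed.

Lemma malg_scalerAr (K : fieldType) (M : monomType) (c : K) (x y : {malg K[M]}) :
  c *: (x * y) = x * (c *: y).
Proof.
rewrite -!mul_malgC mulrA [RHS]mulrA; congr (_ * y).
elim/malg_lin_ind: x => [|a u x IH]; first by rewrite mulr0 mul0r.
have comm : << c *g mone >> * << u >> = << u >> * << c *g mone >> :> {malg K[M]}.
  by rewrite !malgM_def !fgmulUU mul1m mulm1 mulr1 mul1r.
by rewrite mulrDl mulrDr IH -scalerAl -comm mul_malgC [in RHS]mul_malgC !scalerA mulrC.
Qed.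

Section FreeAlgebra.
Variable K : fieldType.

Lemma FA_scalerAr (c : K) (x y : FA K) : c *: (x * y) = x * (c *: y).
Proof. exact: malg_scalerAr. Qed.

(** The words, seen in the free algebra as products of letters; they are its
    monomials ([wdE]). *)
Definition wd (s : word) : FA K := \prod_(a <- s) letter K a.

Lemma wdE (s : {fmonom bool}) : << s >> = wd s :> FA K.
Proof.
case: s => s; rewrite /wd /=; elim: s => [|a s IH].
  by rewrite big_nil -[RHS]/(<< (fmone bool) >>) fmoneE.
rewrite big_cons -IH; apply: esym; apply: etrans (malgUM K (fmu a) (FMonom s)) _.
by rewrite -[mmul _ _]/(fmmul _ _) fmmulE fmuE.
Qed.

Lemma wd_nil : wd [::] = 1. Proof. exact: big_nil. Qed.

Lemma wd_letter a : wd [:: a] = letter K a. Proof. exact: big_seq1. Qed.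

Lemma wd_cat s t : wd (s ++ t) = wd s * wd t.
Proof. exact: big_cat. Qed.

Lemma FA_ind (P : FA K -> Prop) :
  P 0 -> (forall c s x, P x -> P (c *: wd s + x)) -> forall x, P x.
Proof.
move=> P0 PD; apply: malg_lin_ind => // c k x; have := PD c k x.
by rewrite -wdE.
Qed.

Lemma FA_ext (V : lmodType K) (f1 f2 : FA K -> V) :
  linear f1 -> linear f2 -> (forall s, f1 (wd s) = f2 (wd s)) -> f1 =1 f2.
Proof.
move=> l1 l2 e; elim/FA_ind=> [|c s x IH]; first by rewrite !linear_at0.
by rewrite l1 l2 e IH.
Qed.

Lemma FA_mulZDl (c : K) (x y z : FA K) : (c *: x + y) * z = c *: (x * z) + y * z.
Proof. by rewrite mulrDl scalerAl. Qed.

Lemma FA_mulZDr (c : K) (x y z : FA K) : z * (c *: x + y) = c *: (z * x) + z * y.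
Proof. by rewrite mulrDr FA_scalerAr. Qed.

End FreeAlgebra.

(** * Lyndon words and the ideal of relations *)

Lemma ideal_gen_trans (A : nzRingType) (G G' : A -> Prop) :
  (forall g, G g -> ideal_gen G' g) -> forall x, ideal_gen G x -> ideal_gen G' x.
Proof.
move=> GG' x; elim=> [|a g b y Gg _ IH]; first exact: ideal_gen0.
by apply: ideal_genD => //; apply/ideal_genMr/ideal_genMl/GG'.
Qed.

Lemma ideal_gen_bracketl (A : nzRingType) (G : A -> Prop) (x y : A) :
  ideal_gen G x -> ideal_gen G (bracket x y).
Proof.
move=> hx; apply: ideal_genD; first exact: ideal_genMr.
by apply/ideal_genN/ideal_genMl.
Qed.

Lemma ideal_gen_bracketr (A : nzRingType) (G : A -> Prop) (x y : A) :
  ideal_gen G y -> ideal_gen G (bracket x y).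
Proof.
move=> hx; apply: ideal_genD; first exact: ideal_genMl.
by apply/ideal_genN/ideal_genMr.
Qed.

Lemma word_lt_cons (a b : bool) (u v : word) :
  word_lt (a :: u) (b :: v) = (a ==> b) && ((b ==> a) ==> word_lt u v).
Proof. by rewrite /word_lt Order.SeqLexiOrder.ltxi_cons; case: a; case: b. Qed.

Lemma lyndonP (w : word) i : lyndon w -> (0 < i < size w)%N ->
  word_lt w (drop i w ++ take i w).
Proof.
by case/andP=> _ /forallP h /andP[i0 iw]; have /implyP := h (Ordinal iw); apply.
Qed.

(** Otherwise the rotation to the first [g] would be smaller. *)
Lemma lyndon_head (w : word) : lyndon w -> lg \in w -> exists u, w = lg :: u.
Proof.
case: w => [|[] u] // hw; last by exists u.
rewrite inE /= => hu.
have iu : (index lg u < size u)%N by rewrite index_mem.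
have := lyndonP (i := (index lg u).+1) hw; rewrite /= => /(_ iu).
by rewrite (drop_nth lg iu) nth_index // cat_cons word_lt_cons.
Qed.

Lemma count_lg0 (u : word) : count_mem lg u = 0%N -> u = nseq (size u) lh.
Proof. by elim: u => [|[] u IH] //=; rewrite ?add0n // => /IH <-. Qed.

Lemma lyndon_count1 (w : word) :
  lyndon w -> count_mem lg w = 1%N -> exists k, w = omega k.
Proof.
move=> hw cw; have [|u e] := lyndon_head hw.
  by rewrite -has_pred1 has_count cw.
exists (size u); rewrite e /omega {1}(@count_lg0 u) //.
by move: cw; rewrite e /=; lia.
Qed.

Lemma std_cutP (w : word) : (std_cut w < size w)%N ->
  lyndon (take (std_cut w) w) && lyndon (drop (std_cut w) w).
Proof.
rewrite /std_cut => hs.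
have /(nth_find 0%N) : has (fun i => lyndon (take i w) && lyndon (drop i w)) (iota 0 (size w)).
  by rewrite has_find size_iota.
by rewrite nth_iota.
Qed.

Lemma std_cut_gt0 (w : word) : (1 < size w)%N -> (0 < std_cut w)%N.
Proof. by case: w => [|a [|b w]]. Qed.

Section Relations.
Variable K : fieldType.

Definition comm_gens (x : FA K) : Prop :=
  exists a b, x = bracket (E K (omega a)) (E K (omega b)).

Lemma E_rec_nil m : E_rec K m [::] = 0.
Proof. by elim: m => //= m ->; rewrite /bracket mul0r subrr. Qed.

Lemma E_rec_omega m k : (k < m)%N -> E_rec K m (omega k) = E K (omega k).
Proof.
elim: k m => [|k IH] m; first by case: m.
case: m => [|m]; rewrite ?ltn0 ?ltnS => km; first by [].
rewrite E_omegaS; have <- := IH m km.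
rewrite {1}/omega E_recS -[[:: lg, lh & nseq k lh]]/(omega k.+1) std_cut_omega.
have -> : take k.+1 (omega k.+1) = omega k.
  by rewrite -[LHS]/(lg :: take k (nseq k.+1 lh)) take_nseq.
have -> : drop k.+1 (omega k.+1) = [:: lh].
  by rewrite -[LHS]/(drop k (nseq k.+1 lh)) drop_nseq subSnn.
by rewrite E_rec1.
Qed.

(** Descend along the standard factorization [w = uv].  As soon as a factor has
    two letters [g] one concludes by induction; otherwise both factors have
    exactly one, hence are of the form [g h^a] and [g h^b].  When no cut exists
    the recursion returns a bracket with [E [::] = 0]. *)
Lemma E_rec_comm_ideal m w : lyndon w -> (size w <= m)%N ->
  (2 <= count_mem lg w)%N -> ideal_gen comm_gens (E_rec K m w).
Proof.
elim: m w => [|m IH] [|a [|b w]] // lw sz c2; first by case: a {lw sz} c2.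
rewrite E_recS; set v := [:: a, b & w] in lw sz c2 *.
have sz2 : (1 < size v)%N by [].
have := std_cut_gt0 sz2; case: (ltnP (std_cut v) (size v)) => [hc|hc] c0; last first.
  rewrite (drop_oversize hc) E_rec_nil; apply: ideal_gen_bracketr.
  exact: ideal_gen0.
have /andP[l1 l2] := std_cutP hc.
have cc := count_cat (pred1 lg) (take (std_cut v) v) (drop (std_cut v) v).
rewrite cat_take_drop in cc.
have sz1 : (size (take (std_cut v) v) <= m)%N by rewrite size_take hc; lia.
have sz3 : (size (drop (std_cut v) v) <= m)%N by rewrite size_drop; lia.
move: l1 l2 cc sz1 sz3; move: (take _ v) (drop _ v) => u1 u2 l1 l2 cc sz1 sz3.
case: (leqP 2 (count_mem lg u1)) => c1.
  by apply: ideal_gen_bracketl; apply: IH.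
case: (leqP 2 (count_mem lg u2)) => c3.
  by apply: ideal_gen_bracketr; apply: IH.
have [k1 e1] : exists k, u1 = omega k by apply: lyndon_count1 => //; lia.
have [k2 e2] : exists k, u2 = omega k by apply: lyndon_count1 => //; lia.
subst u1 u2; rewrite /= !size_nseq in sz1 sz3.
rewrite (E_rec_omega sz1) (E_rec_omega sz3).
by apply: ideal_gen_generator; exists k1, k2.
Qed.

Lemma gens_I_comm x : gens_I x -> ideal_gen comm_gens x.
Proof. by case=> w [lw c2 ->]; apply: E_rec_comm_ideal. Qed.

Lemma take_omega2 a b : take a.+1 (omega a ++ omega b) = omega a.
Proof. by rewrite take_size_cat //= size_nseq. Qed.

Lemma drop_omega2 a b : drop a.+1 (omega a ++ omega b) = omega b.
Proof. by rewrite drop_size_cat //= size_nseq. Qed.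

Lemma word_gt_nseq_lg a j u v : word_lt (nseq a lh ++ lg :: v) (nseq (a + j.+1) lh ++ u).
Proof.
by elim: a => [|a IH]; rewrite ?addSn /= word_lt_cons // IH.
Qed.

Lemma lyndon_omega2 a b : (a < b)%N -> lyndon (omega a ++ omega b).
Proof.
move=> ab; apply/andP; split=> //; apply/forallP => -[i hi]; apply/implyP => /= i0.
have hi' := hi; rewrite size_cat /= !size_nseq in hi'.
have shape j c u : (0 < j <= c)%N -> drop j (omega c ++ u) = nseq (c - j).+1 lh ++ u.
  case: j => // j; rewrite [(_ < _ <= _)%N]/= => jc.
  rewrite -[LHS]/(drop j (nseq c lh ++ u)) drop_cat size_nseq jc.
  by rewrite drop_nseq; have -> : (c - j)%N = (c - j.+1).+1 by lia.
case: (ltngtP i a.+1) => ia.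
- by rewrite shape // ?i0 ?word_lt_cons //; lia.
- have -> : drop i (omega a ++ omega b) = nseq (b - (i - a.+1)).+1 lh.
    rewrite drop_cat /= size_nseq ltnNge (ltnW ia) /=.
    have := shape (i - a.+1)%N b [::]; rewrite !cats0 => -> //; lia.
  by rewrite word_lt_cons.
rewrite ia drop_omega2 take_omega2 /omega /= word_lt_cons /=.
have {2}-> : b = (a + (b - a.+1).+1)%N by lia.
exact: word_gt_nseq_lg.
Qed.

Lemma std_cut_omega2 a b : (a < b)%N -> std_cut (omega a ++ omega b) = a.+1.
Proof.
move=> ab; set w := omega a ++ omega b; rewrite /std_cut.
set P := fun _ => _.
have sz : size w = (a.+1 + b.+1)%N by rewrite size_cat /= !size_nseq.
have Pa : P a.+1 by rewrite /P take_omega2 drop_omega2 !lyndon_omega.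
have nP i : (i <= a)%N -> ~~ P i.
  case: i => [|i] hi; rewrite /P ?take0 //= negb_and; apply/orP; right.
  rewrite drop_cat size_nseq hi drop_nseq.
  apply/negP => l; have [|u] := lyndon_head l.
    by rewrite mem_cat orbC inE eqxx.
  by rewrite -(prednK (n := (a - i)%N)) ?subn_gt0.
have hP : has P (iota 0 a.+1) = false.
  by apply/negbTE/hasPn => i; rewrite mem_iota => hi; apply: nP; lia.
by rewrite sz iotaD find_cat hP size_iota add0n /= Pa addn0.
Qed.

Lemma E_omega2 a b : (a < b)%N ->
  E K (omega a ++ omega b) = bracket (E K (omega a)) (E K (omega b)).
Proof.
move=> ab; have sz : size (omega a ++ omega b) = (a + b.+1).+1.
  by rewrite size_cat /= !size_nseq.
rewrite -[LHS]/(E_rec K (size (omega a ++ omega b)) (omega a ++ omega b)) sz.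
rewrite [X in E_rec _ _ X]/=; case e : (nseq a lh ++ omega b) => [|c w].
  by move: (congr1 size e); rewrite size_cat /= !size_nseq; lia.
rewrite E_recS -e -[lg :: _]/(omega a ++ omega b) (std_cut_omega2 ab).
have ea : (a < a + b.+1)%N by lia.
have eb : (b < a + b.+1)%N by lia.
by rewrite take_omega2 drop_omega2 (E_rec_omega ea) (E_rec_omega eb).
Qed.

(** For [a < b] the word [g h^a g h^b] is Lyndon and is cut in the middle. *)
Lemma comm_gens_I x : comm_gens x -> ideal_gen (@gens_I K) x.
Proof.
have lt a b : (a < b)%N -> ideal_gen (@gens_I K) (bracket (E K (omega a)) (E K (omega b))).
  move=> ab; rewrite -E_omega2 //; apply: ideal_gen_generator.
  exists (omega a ++ omega b); split=> //; first exact: lyndon_omega2.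
  by rewrite count_cat /= addnA addnS.
case=> a [b ->]; case: (ltngtP a b) => [/lt //|ba|->]; last first.
  by rewrite /bracket subrr; apply: ideal_gen0.
have -> : bracket (E K (omega a)) (E K (omega b)) = - bracket (E K (omega b)) (E K (omega a)).
  by rewrite /bracket opprB.
exact/ideal_genN/lt.
Qed.
End Relations.

(** * Generators and relations of the quotient *)

Lemma rmorph_bracket (A B : nzRingType) (f : {rmorphism A -> B}) x y :
  f (bracket x y) = bracket (f x) (f y).
Proof. by rewrite /bracket rmorphB !rmorphM. Qed.

Section Presentation.
Variables (K : fieldType) (n : nat).
Local Notation T := (Tn K n).
Local Notation x_ := (En K n).
Local Notation g := (gn K n).
Local Notation h := (hn K n).

Definition Tn_rels (z : FA K) : Prop :=
  comm_gens z \/ z = letter K lg ^+ n - 1.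

(** The two successive quotients are one quotient of the free algebra. *)
Lemma pi_n_ker z : pi_n n z = 0 -> ideal_gen Tn_rels z.
Proof.
have lift (y : Tbar K) : ideal_gen (@gens_n K n) y ->
    exists2 z, ideal_gen Tn_rels z & pi_bar z = y.
  elim=> [|a r b w rE _ [t ht <-]]; last rewrite {}rE.
    by exists 0; rewrite ?rmorph0 //; apply: ideal_gen0.
  have [a' <-] : exists x, pi_bar x = a by exact: quot_pi_surj.
  have [b' <-] : exists x, pi_bar x = b by exact: quot_pi_surj.
  exists (a' * (letter K lg ^+ n - 1) * b' + t).
    by apply: ideal_genMD => //; right.
  by rewrite rmorphD !rmorphM rmorphB rmorphXn rmorph1.
move=> /quot_piP /lift[t ht e].
have /quot_piP hI : pi_bar (z - t) = 0 by rewrite rmorphB /= e subrr.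
rewrite -[z](subrK t); apply: ideal_genD => //.
apply: ideal_gen_trans hI => r /gens_I_comm; apply: ideal_gen_trans => c hc.
by apply: ideal_gen_generator; left.
Qed.

Lemma pi_n_rel z : ideal_gen (@comm_gens K) z -> pi_n n z = 0.
Proof.
move=> hz; rewrite /pi_n; have -> : pi_bar z = 0.
  by apply/quot_piP; apply: ideal_gen_trans hz => r /comm_gens_I.
exact: rmorph0.
Qed.

Lemma gn_expn : g ^+ n = 1.
Proof.
apply/eqP; rewrite -subr_eq0; apply/eqP.
rewrite -(rmorphXn (pi_n n)) -(rmorph1 (pi_n n)) -rmorphB.
apply/quot_piP; apply: ideal_gen_generator.
by rewrite /gens_n rmorphB rmorphXn rmorph1.
Qed.

Lemma EnS k : x_ k.+1 = bracket (x_ k) h.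
Proof.
rewrite /En E_omegaS.
exact: (rmorph_bracket (pi_n n : {rmorphism FA K -> Tn K n})).
Qed.

Lemma EnC a b : x_ a * x_ b = x_ b * x_ a.
Proof.
apply/eqP; rewrite -subr_eq0 -!(rmorphM (pi_n n)) -rmorphB; apply/eqP.
by apply: pi_n_rel; apply: ideal_gen_generator; exists a, b.
Qed.

Lemma pi_n_surj (w : T) : exists z, pi_n n z = w.
Proof.
have [u <-] : exists x, quot_pi (@gens_n_proper K n) x = w by exact: quot_pi_surj.
have [z <-] : exists x, pi_bar x = u by exact: quot_pi_surj.
by exists z.
Qed.

Lemma Tn_scalerAr (c : K) (x y : T) : c *: (x * y) = x * (c *: y).
Proof.
have [x' <-] := pi_n_surj x; have [y' <-] := pi_n_surj y.
by rewrite -linearZ -!rmorphM -linearZ FA_scalerAr.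
Qed.

HB.instance Definition _ := GRing.Lalgebra_isAlgebra.Build K T Tn_scalerAr.

Lemma pi_n_wd s : pi_n n (wd K s) = \prod_(a <- s) (if a then h else x_ 0).
Proof. by rewrite /wd (rmorph_prod (pi_n n)); apply: eq_bigr => -[]. Qed.

Lemma pi_n_monomial a j z :
  pi_n n (letter K lh ^+ a * z * letter K lg ^+ j) = h ^+ a * pi_n n z * g ^+ j.
Proof.
rewrite (rmorphM (pi_n n) (_ * z)) (rmorphM (pi_n n) _ z).
by rewrite (rmorphXn (pi_n n) a) (rmorphXn (pi_n n) j).
Qed.

Lemma pi_n_prod_omega (t : seq (nat * nat)) :
  pi_n n (\prod_(q <- t) E K (omega q.1) ^+ q.2) = mon_E K n t.
Proof.
rewrite (rmorph_prod (pi_n n)); apply: eq_bigr => q _.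
exact: (rmorphXn (pi_n n)).
Qed.

Lemma Tn_ind (P : T -> Prop) :
  P 0 -> (forall c s x, P x -> P (c *: (\prod_(a <- s) (if a then h else x_ 0)) + x)) ->
  forall x, P x.
Proof.
move=> P0 PD x; have [z <-] := pi_n_surj x; elim/FA_ind: z => [|c s z IH].
  by rewrite rmorph0.
have -> : pi_n n (c *: wd K s + z) = c *: pi_n n (wd K s) + pi_n n z by exact: linearP.
by rewrite pi_n_wd; apply: PD.
Qed.

End Presentation.

(** * Spanning sets *)

Section Span.
Variables (K : fieldType) (V : lmodType K) (I : eqType) (P : pred I) (F : I -> V).

(** An inductive form of the linear span: closure properties are proved by
    rule induction, and [spanned_spanning] merges repeated indices once and for
    all. *)
Inductive spanned : V -> Prop :=
| spanned0 : spanned 0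
| spannedZD c i x : P i -> spanned x -> spanned (c *: F i + x).

Lemma spannedD x y : spanned x -> spanned y -> spanned (x + y).
Proof.
by elim=> [|c i z Pi _ IH] hy; rewrite ?add0r // -addrA; apply: spannedZD => //; apply: IH.
Qed.

Lemma spannedZ c x : spanned x -> spanned (c *: x).
Proof.
elim=> [|d i z Pi _ IH]; first by rewrite scaler0; apply: spanned0.
by rewrite scalerDr scalerA; apply: spannedZD.
Qed.

Lemma spanned_gen i : P i -> spanned (F i).
Proof.
by move=> Pi; rewrite -[F i]addr0 -[F i]scale1r; apply: spannedZD => //; apply: spanned0.
Qed.

Lemma spanned_spanning : (forall x, spanned x) -> spanning P F.
Proof.
move=> sp x; suff [s [c [_ Ps e]]] : exists (s : seq I) c,
    [/\ uniq s, all P s & x = \sum_(i <- s) c i *: F i] by exists s, c.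
elim: (sp x) => [|c0 i y Pi _ [s [c [us Ps ->]]]].
  by exists [::], (fun=> 0); rewrite big_nil.
case: (boolP (i \in s)) => si.
  exists s, (fun j => if j == i then c0 + c i else c j); split=> //.
  rewrite (bigD1_seq i) //= [in RHS](bigD1_seq i) //= eqxx scalerDl addrA.
  by congr (_ + _); apply: eq_bigr => j /negbTE ->.
exists (i :: s), (fun j => if j == i then c0 else c j); split; rewrite /= ?si ?Pi //.
rewrite big_cons eqxx; congr (_ + _); apply: eq_big_seq => j sj.
by case: eqP sj si => // -> ->.
Qed.
End Span.

(** An algebra generated by [g = x 0] and [h], where the [x k] commute and
    [[x k, h] = x (k+1)].  [A_ind] is the form in which generation is used: every
    element is a combination of words in [g] and [h]. *)
Section OreSpan.
Variables (K : fieldType) (A : algType K) (x_ : nat -> A) (h : A) (n : nat).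
Hypothesis n_gt0 : (0 < n)%N.
Hypothesis xS : forall k, x_ k.+1 = bracket (x_ k) h.
Hypothesis xC : forall a b, x_ a * x_ b = x_ b * x_ a.
Hypothesis x0n : x_ 0 ^+ n = 1.
Hypothesis A_ind : forall P : A -> Prop, P 0 ->
  (forall c (s : word) y, P y ->
     P (c *: (\prod_(a <- s) (if a then h else x_ 0)) + y)) ->
  forall y, P y.
Local Notation g := (x_ 0).
Local Notation L a := (if a then h else g).

Lemma spanned_mulr (I J : eqType) (P : pred I) (F : I -> A) (Q : pred J)
    (G : J -> A) (y : A) :
  (forall i, P i -> spanned Q G (F i * y)) ->
  forall x, spanned P F x -> spanned Q G (x * y).
Proof.
move=> Fy x; elim=> [|c i z Pi _ IH]; first by rewrite mul0r; apply: spanned0.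
by rewrite mulrDl -scalerAl; apply: spannedD => //; apply/spannedZ/Fy.
Qed.

Lemma spanned_mull (I J : eqType) (P : pred I) (F : I -> A) (Q : pred J)
    (G : J -> A) (y : A) :
  (forall i, P i -> spanned Q G (y * F i)) ->
  forall x, spanned P F x -> spanned Q G (y * x).
Proof.
move=> Fy x; elim=> [|c i z Pi _ IH]; first by rewrite mulr0; apply: spanned0.
by rewrite mulrDr -scalerAr; apply: spannedD => //; apply/spannedZ/Fy.
Qed.

Lemma spanned_ore (I : eqType) (P : pred I) (F : I -> A) :
  spanned P F 1 ->
  (forall i, P i -> spanned P F (F i * g)) ->
  (forall i, P i -> spanned P F (F i * h)) ->
  forall x, spanned P F x.
Proof.
move=> F1 Fg Fh; have Fs s x : spanned P F x -> spanned P F (x * \prod_(a <- s) L a).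
  elim: s x => [|a s IH] x hx; first by rewrite big_nil mulr1.
  rewrite big_cons mulrA; apply: IH; apply: spanned_mulr hx => i Pi.
  by case: a; [apply: Fh | apply: Fg].
elim/A_ind=> [|c s x IH]; first exact: spanned0.
by apply: spannedD => //; apply: spannedZ; rewrite -[\prod_(a <- s) _]mul1r; apply: Fs.
Qed.

Lemma expr_reduce j : (j < n)%N -> exists2 i, (i < n)%N & g ^+ j * g = g ^+ i.
Proof.
rewrite -exprSr leq_eqVlt => /orP[/eqP ->|jn]; last by exists j.+1.
by exists 0%N; rewrite // x0n.
Qed.

(** The commutative subalgebra generated by the [E_(omega_k)]. *)
Inductive Ealg : A -> Prop :=
| Ealg1 : Ealg 1
| Ealg_gen k : Ealg (x_ k)
| EalgD y z : Ealg y -> Ealg z -> Ealg (y + z)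
| EalgM y z : Ealg y -> Ealg z -> Ealg (y * z)
| EalgZ c y : Ealg y -> Ealg (c *: y).

Lemma Ealg_comm y z : Ealg y -> Ealg z -> y * z = z * y.
Proof.
have gen k t : Ealg t -> x_ k * t = t * x_ k.
  elim=> {t} [|l|t u _ IH1 _ IH2|t u _ IH1 _ IH2|c t _ IH].
  - by rewrite mulr1 mul1r.
  - exact: xC.
  - by rewrite mulrDl mulrDr IH1 IH2.
  - by rewrite mulrA IH1 -mulrA IH2 mulrA.
  - by rewrite -scalerAr -scalerAl IH.
move=> hy hz; elim: hy => {y} [|l|t u _ IH1 _ IH2|t u _ IH1 _ IH2|c t _ IH].
- by rewrite mulr1 mul1r.
- exact: gen.
- by rewrite mulrDl mulrDr IH1 IH2.
- by rewrite -mulrA IH2 mulrA IH1 mulrA.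
- by rewrite -scalerAr -scalerAl IH.
Qed.

Lemma Ealg_exp y m : Ealg y -> Ealg (y ^+ m).
Proof.
move=> hy; elim: m => [|m IH]; first exact: Ealg1.
by rewrite exprS; apply: EalgM.
Qed.

Lemma Ealg_g : Ealg g. Proof. exact: (Ealg_gen 0). Qed.

Lemma Ealg0 : Ealg 0.
Proof. by rewrite -(scale0r (1 : A)); apply: EalgZ; apply: Ealg1. Qed.

(** Commutation with [h] is a derivation which maps [E_(omega_k)] to
    [E_(omega_(k+1))]. *)
Lemma Ealg_bracket y : Ealg y -> Ealg (bracket y h).
Proof.
rewrite /bracket; elim=> {y} [|l|t u _ IH1 _ IH2|t u ht IH1 hu IH2|c t _ IH].
- by rewrite mulr1 mul1r subrr; apply: Ealg0.
- by rewrite -[_ - _]/(bracket _ _) -xS; apply: Ealg_gen.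
- by rewrite mulrDl mulrDr opprD addrACA; apply: EalgD.
- have -> : t * u * h - h * (t * u) = t * (u * h - h * u) + (t * h - h * t) * u.
    by rewrite mulrBr mulrBl !mulrA subrKA.
  by apply: EalgD; apply: EalgM.
- by rewrite -scalerAl -scalerAr -scalerBr; apply: EalgZ.
Qed.

Definition ord_exps (t : seq (nat * nat)) : bool :=
  sorted gtn [seq q.1 | q <- t] && all (fun q => (1 <= q.1)%N && (1 <= q.2)%N) t.

(** Multiplication of an ordered monomial by [x k], on exponents: the new factor
    is moved to its place in the decreasing order. *)
Fixpoint insert_exp (k : nat) (t : seq (nat * nat)) : seq (nat * nat) :=
  if t is q :: u then
    if k == q.1 then (k, q.2.+1) :: u
    else if (q.1 < k)%N then (k, 1%N) :: t
    else q :: insert_exp k u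
  else [:: (k, 1%N)].

Definition monE (t : seq (nat * nat)) : A := \prod_(q <- t) x_ q.1 ^+ q.2.

Definition ore_mon (i : nat * seq (nat * nat) * nat) : A :=
  h ^+ i.1.1 * monE i.1.2 * g ^+ i.2.

Lemma Ealg_monE t : Ealg (monE t).
Proof.
rewrite /monE; elim: t => [|q t IH]; first by rewrite big_nil; apply: Ealg1.
by rewrite big_cons; apply: EalgM => //; apply/Ealg_exp/Ealg_gen.
Qed.

Lemma monE_insert k t : monE t * x_ k = monE (insert_exp k t).
Proof.
have comm y : Ealg y -> y * x_ k = x_ k * y by move=> hy; apply: Ealg_comm => //; apply: Ealg_gen.
rewrite /monE; elim: t => [|[l m] t IH] /=.
  by rewrite !big_cons !big_nil mul1r mulr1.
case: eqVneq => [e|_]; last case: ltnP => _.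
- subst l; rewrite !big_cons /= -mulrA comm; last exact: Ealg_monE.
  by rewrite mulrA -exprSr.
- rewrite comm; last exact: (Ealg_monE (_ :: _)).
  by rewrite [RHS]big_cons.
- by rewrite !big_cons -mulrA IH.
Qed.

Lemma ord_exps_insert k t : (0 < k)%N -> ord_exps t -> ord_exps (insert_exp k t).
Proof.
move=> k0; rewrite /ord_exps; elim: t => [|[l m] t IH] /=; first by rewrite k0.
case/andP=> pt /andP[lm at_]; case: eqVneq => [e|kl]; last case: ltnP => lk /=.
- by subst l; rewrite /= pt k0.
- by rewrite lk pt k0 lm.
have lt : (k < l)%N by rewrite ltn_neqAle kl.
have /IH /andP[st ->] : ord_exps t.
  by rewrite /ord_exps at_ (path_sorted pt).
rewrite lm !andbT; move: pt st; case: {IH at_} t => [|[l' m'] t] /=; first by rewrite lt.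
case/andP=> ll' pt; case: eqVneq => [e|_]; last case: ltnP => _ /=.
- by rewrite /= lt.
- by rewrite lt.
- by rewrite ll'.
Qed.

Local Notation W0 := (spanned
  (fun p : seq (nat * nat) * nat => ord_exps p.1 && (p.2 < n)%N)
  (fun p => monE p.1 * g ^+ p.2)).
Local Notation W := (spanned (mon_index n) ore_mon).

Lemma Ealg_spanned y : Ealg y -> W0 y.
Proof.
suff mul z : Ealg z -> forall w, W0 w -> W0 (w * z).
  move=> hy; rewrite -[y]mul1r; apply: mul hy _ _.
  have := @spanned_gen _ _ _ (fun p : seq (nat * nat) * nat => ord_exps p.1 && (p.2 < n)%N)
    (fun p => monE p.1 * g ^+ p.2) ([::], 0%N).
  by rewrite /= /monE big_nil mulr1; apply.
elim=> {z} [|k|t u _ IH1 _ IH2|t u _ IH1 _ IH2|c t _ IH] w hw.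
- by rewrite mulr1.
- apply: spanned_mulr hw => -[t j] /= /andP[ht jn].
  case: k => [|k].
    have [i iN e] := expr_reduce jn; rewrite -mulrA e.
    by apply: (@spanned_gen _ _ _ _ (fun p => monE p.1 * g ^+ p.2) (t, i)); rewrite /= ht.
  rewrite -mulrA (@Ealg_comm (g ^+ j)); [|exact/Ealg_exp/Ealg_g|exact: Ealg_gen].
  rewrite mulrA monE_insert.
  apply: (@spanned_gen _ _ _ _ (fun p => monE p.1 * g ^+ p.2) (insert_exp k.+1 t, j)).
  by rewrite /= jn ord_exps_insert.
- by rewrite mulrDr; apply: spannedD; [apply: IH1 | apply: IH2].
- by rewrite mulrA; apply: IH2; apply: IH1.
- by rewrite -scalerAr; apply/spannedZ/IH.
Qed.

Lemma hEalg_spanned a y : Ealg y -> W (h ^+ a * y).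
Proof.
move/Ealg_spanned; apply: spanned_mull => -[t j] /= /andP[/andP[st pt] jn].
rewrite mulrA -[X in spanned _ _ X]/(ore_mon (a, t, j)).
by apply: spanned_gen; rewrite /mon_index /= st pt.
Qed.

(** [h^a c h = h^(a+1) c + h^a [c, h]], and [[c, h]] stays in [Ealg]. *)
Lemma mon_spanning : spanning (mon_index n) ore_mon.
Proof.
apply/spanned_spanning/spanned_ore.
- by rewrite -[1]mul1r -[X in X * _](expr0 h); apply: hEalg_spanned; apply: Ealg1.
- move=> [[a t] j] _; rewrite /ore_mon -!mulrA; apply: hEalg_spanned.
  by apply: EalgM; [apply: Ealg_monE | rewrite -exprSr; apply/Ealg_exp/Ealg_g].
move=> [[a t] j] _; rewrite /ore_mon /= -mulrA.
set y := monE t; rewrite -[h ^+ a * y * _]mulrA [y * _]mulrA.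
have hy : Ealg (y * g ^+ j).
  by apply: EalgM; [apply: Ealg_monE | apply/Ealg_exp/Ealg_g].
rewrite -[_ * h](subrK (h * (y * g ^+ j))) mulrDr [h ^+ a * (h * _)]mulrA -exprSr.
by apply: spannedD; apply: hEalg_spanned => //; apply: Ealg_bracket.
Qed.

Section Commutative.
Hypothesis E1 : x_ 1 = 0.

Lemma ghC : g * h = h * g.
Proof. by apply/eqP; rewrite -subr_eq0 -[_ - _]/(bracket g h) -xS E1. Qed.

Lemma ore_comm (y z : A) : y * z = z * y.
Proof.
have LC a b : L a * L b = L b * L a by case: a; case: b; rewrite ?ghC.
have gC a t : L a * t = t * L a.
  elim/A_ind: t => [|c s t IH]; first by rewrite mulr0 mul0r.
  rewrite mulrDl mulrDr IH -scalerAr -scalerAl; congr (_ *: _ + _).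
  elim: s => [|b s IHs]; first by rewrite big_nil mulr1 mul1r.
  by rewrite !big_cons mulrA LC -mulrA IHs mulrA.
elim/A_ind: y => [|c s y IH]; first by rewrite mulr0 mul0r.
rewrite mulrDl mulrDr IH -scalerAr -scalerAl; congr (_ *: _ + _).
elim: s => [|b s IHs]; first by rewrite big_nil mulr1 mul1r.
by rewrite !big_cons -mulrA IHs mulrA (gC b z) -mulrA.
Qed.

Lemma hg_spanning :
  spanning (fun i : nat * nat => (i.2 < n)%N) (fun i => h ^+ i.1 * g ^+ i.2).
Proof.
pose F (i : nat * nat) := h ^+ i.1 * g ^+ i.2.
apply/spanned_spanning/spanned_ore.
- have := @spanned_gen _ _ _ (fun i : nat * nat => (i.2 < n)%N) F (0%N, 0%N).
  by rewrite /F /= mulr1; apply.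
- move=> [a j] /= jn; have [i iN e] := expr_reduce jn; rewrite -mulrA e.
  exact: (@spanned_gen _ _ _ (fun i : nat * nat => (i.2 < n)%N) F (a, i)).
move=> [a j] /= jn; rewrite -mulrA (ore_comm (g ^+ j)) mulrA -exprSr.
exact: (@spanned_gen _ _ _ (fun i : nat * nat => (i.2 < n)%N) F (a.+1, j)).
Qed.
End Commutative.
End OreSpan.

(** * Right modules over the free algebra *)

Section RightAction.
Variables (K : fieldType) (V : lmodType K) (op : bool -> V -> V).
Hypothesis op_linear : forall a, linear (op a).

Definition word_act (s : word) (v : V) : V := foldl (fun u a => op a u) v s.

(** Letters are read from left to right, which makes [V] a right module. *)
Definition ract (z : FA K) (v : V) : V :=
  linext (fun w : {fmonom bool} => word_act w v) z.

Lemma word_act_linear s : linear (word_act s).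
Proof.
elim: s => [|a s IH] c u v //=.
by rewrite /word_act /= op_linear; apply: IH.
Qed.

Lemma ractDZ c y z v : ract (c *: y + z) v = c *: ract y v + ract z v.
Proof. exact: linearP. Qed.

Lemma ract0 v : ract 0 v = 0.
Proof. exact: linear0. Qed.

Lemma ractD y z v : ract (y + z) v = ract y v + ract z v.
Proof. exact: linearD. Qed.

Lemma ractB y z v : ract (y - z) v = ract y v - ract z v.
Proof. exact: linearB. Qed.

Lemma ract_wd s v : ract (wd K s) v = word_act s v.
Proof.
have -> : wd K s = << (FMonom s : {fmonom bool}) >> by rewrite wdE.
by rewrite /ract linextU scale1r.
Qed.

Lemma ract_linear z : linear (ract z).
Proof.
move=> c u v; elim/FA_ind: z => [|d s z IH]; first by rewrite !ract0 scaler0 addr0.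
rewrite !ractDZ IH !ract_wd word_act_linear !scalerDr !scalerA [d * c]mulrC.
by rewrite addrACA.
Qed.

Lemma ractM y z v : ract (y * z) v = ract z (ract y v).
Proof.
move: y; apply: FA_ext => [c y1 y2|c y1 y2|s].
- by rewrite (FA_mulZDl c y1 y2 z) (ractDZ c (y1 * z)).
- by rewrite (ractDZ c y1) (ract_linear z).
rewrite ract_wd; move: z; apply: FA_ext => [c z1 z2|c z1 z2|t].
- by rewrite (FA_mulZDr c z1 z2) (ractDZ c (wd K s * z1)).
- exact: (ractDZ c z1).
by rewrite -wd_cat !ract_wd /word_act foldl_cat.
Qed.

Lemma ract_bracket y z v :
  ract (bracket y z) v = ract z (ract y v) - ract y (ract z v).
Proof. by rewrite -(ractM y z) -(ractM z y) -(ractB (y * z)). Qed.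

Lemma ract_letter a v : ract (letter K a) v = op a v.
Proof.
by rewrite -wd_letter ract_wd.
Qed.

Lemma ract1 v : ract 1 v = v.
Proof.
by rewrite -wd_nil ract_wd.
Qed.
End RightAction.

(** * The differential polynomial ring *)

(** The polynomial ring in [x_0, x_1, ...], given by its monomials [mon u] and by
    linear extension from monomials. *)
Section Model.
Variables (K : fieldType).
Local Notation M := {cmonom nat}.
Variables (P : comAlgType K) (mon : M -> P).
Variable ext : forall V : lmodType K, (M -> V) -> {linear P -> V}.
Hypothesis monM : forall u v, mon (mmul u v) = mon u * mon v.
Hypothesis mon1 : mon mone = 1.
Hypothesis mon_ind : forall Q : P -> Prop, Q 0 ->
  (forall c u f, Q f -> Q (c *: mon u + f)) -> forall f, Q f.
Hypothesis extE : forall (V : lmodType K) (F : M -> V) u, ext F (mon u) = F u.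
Local Notation xx k := (mon (ucm k)).

Definition upow (k m : nat) : M := iter m (mmul (ucm k)) mone.

Lemma upowE k m j : upow k m j = if k == j then m else 0%N.
Proof.
rewrite /upow; elim: m => [|m IH]; first by rewrite cm1; case: eqP.
by rewrite iterS cmM IH cmU; case: eqP.
Qed.

Lemma mon_upow k m : mon (upow k m) = xx k ^+ m.
Proof. by elim: m => [|m IH]; rewrite /upow ?mon1 // iterS monM IH exprS. Qed.

Definition uprod (t : seq (nat * nat)) : M :=
  foldr (fun q u => mmul (upow q.1 q.2) u) mone t.

Lemma mon_uprod t : mon (uprod t) = \prod_(q <- t) xx q.1 ^+ q.2.
Proof.
elim: t => [|q t IH] /=; first by rewrite big_nil mon1.
by rewrite monM IH mon_upow big_cons.
Qed.

(** The derivation of the polynomial ring with [x_k |-> x_(k+1)]. *)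
Definition shift_der_mon (u : M) : P :=
  \sum_(k <- finsupp u) (u k)%:R *: mon (mmul (ucm k.+1) (divcm u (ucm k))).

Lemma shift_der_monE (d : {fset nat}) (u : M) : (finsupp u `<=` d)%fset ->
  shift_der_mon u = \sum_(k <- d) (u k)%:R *: mon (mmul (ucm k.+1) (divcm u (ucm k))).
Proof.
move=> le; rewrite /shift_der_mon; apply: big_fset_incl => //= k _.
by rewrite -cmE_eq0 => /eqP ->; rewrite scale0r.
Qed.

Lemma shift_der_mon1 : shift_der_mon mone = 0.
Proof. by rewrite /shift_der_mon mdom1 big_seq_fset0. Qed.

Lemma shift_der_monU k : shift_der_mon (ucm k) = xx k.+1.
Proof.
rewrite /shift_der_mon mdomU big_seq_fset1 cmUU scale1r.
congr mon; apply/eqP/cmP => j; rewrite cmM divcmE !cmU; lia.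
Qed.

Lemma shift_der_monM u v :
  shift_der_mon (mmul u v) = shift_der_mon u * mon v + mon u * shift_der_mon v.
Proof.
have le : (finsupp (mmul u v) `<=` finsupp u `|` finsupp v)%fset by rewrite mdomD.
rewrite (shift_der_monE le) (shift_der_monE (fsubsetUl _ (finsupp v))).
rewrite (shift_der_monE (fsubsetUr (finsupp u) _)).
rewrite mulr_suml mulr_sumr -big_split /=; apply: eq_bigr => k _.
rewrite cmM natrD scalerDl -scalerAl -scalerAr -!monM; congr (_ + _).
  have [->|u0] := posnP (u k); first by rewrite !scale0r.
  congr (_ *: mon _); apply/eqP/cmP => j; rewrite !(cmM, divcmE, cmU).
  by case: (eqVneq k j) => [<-|_]; lia.
have [->|u0] := posnP (v k); first by rewrite !scale0r.
congr (_ *: mon _); apply/eqP/cmP => j; rewrite !(cmM, divcmE, cmU).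
by case: (eqVneq k j) => [<-|_]; lia.
Qed.

Definition shift_der : {linear P -> P} := ext shift_der_mon.

Lemma shift_derU k : shift_der (xx k) = xx k.+1.
Proof. by rewrite /shift_der extE shift_der_monU. Qed.

Lemma shift_derM f e : shift_der (f * e) = shift_der f * e + f * shift_der e.
Proof.
elim/mon_ind: f => [|c u f IH]; first by rewrite !(mul0r, raddf0) addr0.
rewrite mulrDl raddfD /= IH linearP mulrDl mulrDl addrACA; congr (_ + _).
rewrite -!scalerAl linearZ -scalerDr /=; congr (_ *: _) => {IH f}.
elim/mon_ind: e => [|d v e IH]; first by rewrite !(mulr0, raddf0) addr0.
rewrite mulrDr raddfD /= IH linearP !mulrDr addrACA; congr (_ + _).
rewrite -!scalerAr linearZ -scalerDr /=; congr (_ *: _).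
by rewrite -monM /shift_der !extE shift_der_monM.
Qed.

Lemma shift_derX f m : shift_der (f ^+ m) = (f ^+ m.-1 * shift_der f) *+ m.
Proof.
elim: m => [|m IH]; last first.
  rewrite exprS shift_derM IH mulrnAr mulrA -exprS mulrS mulrC.
  by case: m {IH} => [|m].
by rewrite mulr0n expr0 -mon1 /shift_der extE shift_der_mon1.
Qed.

Section Quotient.
Variable n : nat.

Definition cyc_ideal (f : P) : Prop := exists q, f = (xx 0 ^+ n - 1) * q.

Lemma cyc_ideal0 : cyc_ideal 0. Proof. by exists 0; rewrite mulr0. Qed.

Lemma cyc_idealD f e : cyc_ideal f -> cyc_ideal e -> cyc_ideal (f + e).
Proof. by move=> [q ->] [r ->]; exists (q + r); rewrite mulrDr. Qed.

Lemma cyc_idealMr f e : cyc_ideal f -> cyc_ideal (f * e).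
Proof. by move=> [q ->]; exists (q * e); rewrite mulrA. Qed.

Lemma cyc_idealZ c f : cyc_ideal f -> cyc_ideal (c *: f).
Proof. by move=> [q ->]; exists (c *: q); rewrite scalerAr. Qed.

(** As [n = 0] in [K], the polynomial [x_0^n - 1] is a constant of the
    derivation, whence a differential ideal. *)
Lemma cyc_ideal_shift f : (n%:R : K) = 0 -> cyc_ideal f -> cyc_ideal (shift_der f).
Proof.
move=> n0 [q ->]; exists (shift_der q); rewrite shift_derM raddfB /= shift_derX.
have -> : shift_der 1 = 0 by have := shift_derX 1 0; rewrite mulr0n expr0.
have -> : forall y : P, y *+ n = 0.
  by move=> y; rewrite -scaler_nat n0 scale0r.
by rewrite subrr mul0r add0r.
Qed.

Definition same_class (u v : M) : bool :=
  `[< u 0%N = v 0%N %[mod n] /\ forall k, k != 0%N -> u k = v k >].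

(** [class_coef v f] is the coefficient of the class of [v] in the residue of [f]
    modulo [x_0^n = 1]; this linear form vanishes on [cyc_ideal] and tells reduced
    monomials apart. *)
Definition class_coef (v : M) : {linear P -> K^o} :=
  ext (V := K^o) (fun u => (same_class u v)%:R).

Lemma class_coefU v u : class_coef v (mon u) = (same_class u v)%:R.
Proof. by rewrite /class_coef extE. Qed.

Lemma class_coef_cyc_ideal v f : cyc_ideal f -> class_coef v f = 0.
Proof.
case=> q ->; elim/mon_ind: q => [|c u q IH].
  by rewrite mulr0 linear0.
rewrite mulrDr -scalerAr linearP IH addr0.
suff -> : class_coef v ((xx 0 ^+ n - 1) * mon u) = 0 by rewrite scaler0.
rewrite mulrBl mul1r linearB /= -mon_upow -monM.
rewrite !class_coefU; apply/eqP; rewrite subr_eq0; apply/eqP; congr (_%:R); congr nat_of_bool.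
apply: asbool_equiv_eq; rewrite cmM upowE eqxx modnDl.
by split=> -[h1 h2]; split=> // k k0; have := h2 k k0; rewrite cmM upowE eq_sym (negbTE k0).
Qed.

Lemma same_class_eq (u v : M) : (u 0 < n)%N -> (v 0 < n)%N -> same_class u v -> u = v.
Proof.
move=> un vn /asboolP[h0 h]; apply/eqP/cmP => k.
by case: (eqVneq k 0%N) => [->|/h //]; move: h0; rewrite !modn_small.
Qed.

Lemma reduced_indep (I : eqType) (s : seq I) (c : I -> K) (u : I -> M) :
  uniq s -> (forall i, i \in s -> u i 0 < n)%N -> {in s &, injective u} ->
  cyc_ideal (\sum_(i <- s) c i *: mon (u i)) -> forall i, i \in s -> c i = 0.
Proof.
move=> us un ui hJ i si; have := class_coef_cyc_ideal (u i) hJ.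
rewrite linear_sum /= (bigD1_seq i) //=.
rewrite big_seq_cond big1 => [|j /andP[sj ji]]; rewrite linearZ /= class_coefU.
  have -> : same_class (u i) (u i) by apply/asboolP.
  by rewrite addr0 => <-; rewrite /GRing.scale /= mulr1.
case: (boolP (same_class _ _)) => [/same_class_eq|_]; last by rewrite scaler0.
by move=> /(_ (un _ sj) (un _ si)) /ui e; rewrite e ?eqxx in ji.
Qed.

(** Let [g] act by multiplication by [x_0] and [h] by an operator [H] such that
    [H (f * e_k) - H f * e_k = f * e_(k+1)] for a sequence [e_k] with
    [e_0 = x_0].  Then [E_(omega_k)] acts by multiplication by [e_k], and the
    relations of [Tn] hold modulo [cyc_ideal]. *)
Section Operator.
Variables (H : P -> P) (e : nat -> P).
Hypothesis H_linear : linear H.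
Hypothesis H_J : forall f, cyc_ideal f -> cyc_ideal (H f).
Hypothesis e0 : e 0 = xx 0.
Hypothesis H_e : forall k f, H (f * e k) - H f * e k = f * e k.+1.

Definition opn (a : bool) (f : P) : P := if a then H f else f * xx 0.

Lemma opn_linear a : linear (opn a).
Proof.
case: a => c f q; rewrite /opn; first exact: H_linear.
by rewrite mulrDl scalerAl.
Qed.
Local Notation act := (ract opn).
Let actM := ractM opn_linear.
Let actL : forall a f, act (letter K a) f = opn a f := ract_letter opn.

Lemma act_omega k f : act (E K (omega k)) f = f * e k.
Proof.
elim: k f => [|k IH] f; first by rewrite E_omega0 actL e0.
by rewrite E_omegaS (ract_bracket opn_linear) !actL !IH H_e.
Qed.

Lemma act_cyc_ideal z f : cyc_ideal f -> cyc_ideal (act z f).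
Proof.
move=> hf; elim/FA_ind: z => [|c s z IH]; first by rewrite ract0; apply: cyc_ideal0.
rewrite ractDZ; apply: cyc_idealD => //; apply: cyc_idealZ; rewrite ract_wd /word_act.
elim: s f hf {IH z} => //= -[] s IH f hf; apply: IH; [exact: H_J | exact: cyc_idealMr].
Qed.

(** The [e_k] commute, and [g^n - 1] multiplies by [x_0^n - 1]; the ideal is stable
    under the action, so that everything in the kernel of [pi_n] maps into it. *)
Lemma act_ker z f : pi_n n z = 0 -> cyc_ideal (act z f).
Proof.
move/pi_n_ker => hz; elim: hz f => [|a r b y hr _ IH] f.
  by rewrite ract0; apply: cyc_ideal0.
rewrite ractD !actM; apply: cyc_idealD => //; apply: act_cyc_ideal.
case: hr => [[k [l ->]]|->].
  by rewrite (ract_bracket opn_linear) !act_omega mulrAC subrr; apply: cyc_ideal0.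
set f' := act a f; rewrite ractB ract1.
suff -> : act (letter K lg ^+ n) f' = f' * xx 0 ^+ n.
  by exists f'; rewrite mulrBl mul1r mulrC.
elim: n => [|m IHm]; first by rewrite !expr0 ract1 mulr1.
by rewrite !exprSr actM IHm ract_letter /opn mulrA.
Qed.
Lemma act_expn z m f : act (z ^+ m) f = iter m (act z) f.
Proof.
elim: m => [|m IH]; first by rewrite expr0 ract1.
by rewrite exprSr (actM (z ^+ m)) IH.
Qed.

Lemma act_monomial a t j f :
  act (letter K lh ^+ a * (\prod_(q <- t) E K (omega q.1) ^+ q.2) * letter K lg ^+ j) f
  = iter a H f * (\prod_(q <- t) e q.1 ^+ q.2) * xx 0 ^+ j.
Proof.
rewrite (actM (_ * _)) (actM (_ ^+ a)) (act_expn (letter K lh)).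
have -> : iter a (act (letter K lh)) f = iter a H f.
  by elim: a => //= a ->; rewrite actL.
have act_pow z x m f' : (forall f, act z f = f * x) -> act (z ^+ m) f' = f' * x ^+ m.
  move=> hz; rewrite act_expn; elim: m => [|m IH]; first by rewrite mulr1.
  by rewrite iterS IH hz exprSr mulrA.
have -> (f' : P) : act (\prod_(q <- t) E K (omega q.1) ^+ q.2) f' =
    f' * \prod_(q <- t) e q.1 ^+ q.2.
  elim: t f' => [|q t IH] f'; first by rewrite !big_nil ract1 mulr1.
  rewrite !big_cons (actM (_ ^+ q.2)) IH mulrA; congr (_ * _).
  by apply: act_pow => f1; apply: act_omega.
by apply: act_pow => f1; rewrite actL.
Qed.

Lemma act_indep (I : eqType) (s : seq I) (c : I -> K) (F : I -> FA K) (f : P) (u : I -> M)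
    (G : I -> Tn K n) :
  uniq s -> (forall i, pi_n n (F i) = G i) -> {in s, forall i, act (F i) f = mon (u i)} ->
  {in s, forall i, (u i 0 < n)%N} -> {in s &, injective u} ->
  \sum_(i <- s) c i *: G i = 0 -> forall i, i \in s -> c i = 0.
Proof.
move=> us FG Fu un ui sum0; apply: (reduced_indep us un ui).
have -> : \sum_(i <- s) c i *: mon (u i) = act (\sum_(i <- s) c i *: F i) f.
  elim: s Fu {us un ui sum0} => [|i s IH] Fu; first by rewrite !big_nil ract0.
  rewrite !big_cons ractDZ Fu ?mem_head // IH // => j js.
  by apply: Fu; rewrite inE js orbT.
apply: act_ker; rewrite -[RHS]sum0.
elim: s {us Fu un ui sum0} => [|i s IH]; first by rewrite !big_nil rmorph0.
by rewrite !big_cons -IH -FG (linearP (pi_n n)).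
Qed.
End Operator.

(** Let [h] multiply by [x_1].  Then the [E_(omega_k)] with [k >= 1] act by zero, and
    [h^i g^j] maps [1] to [x_1^i x_0^j]. *)
Lemma hg_indep : lin_indep (fun i : nat * nat => (i.2 < n)%N)
  (fun i => hn K n ^+ i.1 * gn K n ^+ i.2).
Proof.
pose H (f : P) := f * xx 1; pose e k := if k == 0%N then xx 0 else 0.
have H_linear : linear H by move=> c f q; rewrite /H mulrDl scalerAl.
have H_J f : cyc_ideal f -> cyc_ideal (H f) by apply: cyc_idealMr.
have H_e k f : H (f * e k) - H f * e k = f * e k.+1.
  by rewrite /H mulrAC subrr mulr0.
move=> s c us Ps sum0.
pose F (i : nat * nat) := letter K lh ^+ i.1 *
  (\prod_(q <- [::]) E K (omega q.1) ^+ q.2) * letter K lg ^+ i.2.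
pose u (i : nat * nat) := mmul (upow 1 i.1) (upow 0 i.2).
have u0 i : u i 0%N = i.2 by rewrite /u cmM !upowE.
have u1 i : u i 1%N = i.1 by rewrite /u cmM !upowE addn0.
have e0 : e 0%N = xx 0 by [].
refine (act_indep H_linear H_J e0 H_e (F := F) (f := 1) (u := u) us _ _ _ _ sum0).
- by move=> i; rewrite /F pi_n_monomial pi_n_prod_omega /mon_E big_nil mulr1.
- move=> i _; rewrite (act_monomial H_linear e0 H_e) big_nil mulr1.
  rewrite /u monM !mon_upow; congr (_ * _); elim: i.1 => //= a ->.
  by rewrite /H exprSr.
- by move=> i /(allP Ps); rewrite u0.
- move=> i i' _ _ eu; rewrite [i]surjective_pairing [i']surjective_pairing.
  by rewrite -(u0 i) -(u1 i) eu u0 u1.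
Qed.

(** The monomial remembers the list of its factors, because keys are distinct
    and exponents positive; the order is then forced. *)
Lemma mem_uprod t k m : ord_exps t -> (0 < m)%N ->
  ((k, m) \in t) = (uprod t k == m).
Proof.
move=> /andP[]; elim: t => [|[l b] t IH] /= pt; first by rewrite cm1; case: m.
move=> /andP[/andP[l0 b0] at_] m0; have st := path_sorted pt.
rewrite inE xpair_eqE IH // cmM upowE eq_sym.
case: eqVneq => [e|_] /=; last by rewrite add0n.
subst l; suff -> : uprod t k = 0%N by rewrite addn0 eq_sym; lia.
have : all (gtn k) [seq q.1 | q <- t].
  by apply: order_path_min pt => x y z /= h1 h2; apply: ltn_trans h2 h1.
elim: t {IH pt at_ st} => [|q t IH] /=; first by rewrite cm1.
by case/andP=> qk /IH; rewrite cmM upowE => ->; case: eqP qk => // ->; rewrite ltnn.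
Qed.

Lemma uprod_inj t t' : ord_exps t -> ord_exps t' -> uprod t = uprod t' -> t = t'.
Proof.
move=> ht ht' e.
have st u : ord_exps u -> sorted (fun q r : nat * nat => (r.1 < q.1)%N) u.
  by case/andP; rewrite sorted_map.
apply: (irr_sorted_eq (leT := fun q r : nat * nat => (r.1 < q.1)%N)) (st _ ht) (st _ ht') _.
- by move=> x y z /= h1 h2; apply: ltn_trans h2 h1.
- by move=> x; rewrite /= ltnn.
move=> [k [|m]]; last by rewrite !mem_uprod // e.
have no u : ord_exps u -> (k, 0%N) \in u = false.
  by case/andP=> _ /allP h; apply/negP => /h; rewrite andbF.
by rewrite !no.
Qed.

Lemma uprod0 t : ord_exps t -> uprod t 0 = 0%N.
Proof.
case/andP=> _; elim: t => [|q t IH] /=; first by rewrite cm1.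
by case/andP=> /andP[q0 _] /IH; rewrite cmM upowE => ->; case: eqP q0 => // ->.
Qed.

Lemma iter_shift_der m a : iter a shift_der (xx m) = xx (m + a)%N.
Proof. by elim: a => [|a IH]; rewrite ?addn0 // iterS IH shift_derU addnS. Qed.

(** Let [h] act by the derivation, and apply a relation to [x_N]: the monomial of
    index [(a, t, j)] yields [x_(N+a)] times a monomial in the variables with
    indices below [N], so that [a], [t] and [j] can be read off. *)
Lemma mon_indep : (n%:R : K) = 0 -> lin_indep (mon_index n) (@Defs.mon K n).
Proof.
move=> n0; pose e k := xx k.
have H_J f : cyc_ideal f -> cyc_ideal (shift_der f) by apply: cyc_ideal_shift.
have H_e k f : shift_der (f * e k) - shift_der f * e k = f * e k.+1.
  by rewrite shift_derM shift_derU addrAC subrr add0r.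
have H_lin : linear shift_der by exact: linearP.
move=> s c us Ps sum0.
have [N N0 Nt] : exists2 N, (0 < N)%N & forall i k, i \in s -> uprod i.1.2 (N + k)%N = 0%N.
  exists (\sum_(i <- s) \sum_(q <- i.1.2) q.1).+1 => // i k si.
  have : (\sum_(q <- i.1.2) q.1 < (\sum_(i <- s) \sum_(q <- i.1.2) q.1).+1 + k)%N.
    by rewrite (big_rem i) //=; lia.
  move: (_ + k)%N => N; elim: i.1.2 => [|q t IH] /=; first by rewrite cm1.
  rewrite big_cons cmM upowE => h.
  rewrite IH; last exact: leq_ltn_trans (leq_addl _ _) h.
  by case: eqP => // e1; rewrite e1 ltnNge leq_addr in h.
have Nk0 k : (N + k == 0)%N = false by rewrite eqn0Ngt addn_gt0 N0.
have N0k k : (0 == N + k)%N = false by rewrite eq_sym Nk0.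
pose F (i : nat * seq (nat * nat) * nat) := letter K lh ^+ i.1.1 *
  (\prod_(q <- i.1.2) E K (omega q.1) ^+ q.2) * letter K lg ^+ i.2.
pose u (i : nat * seq (nat * nat) * nat) :=
  mmul (mmul (ucm (N + i.1.1)%N) (uprod i.1.2)) (upow 0 i.2).
have sP i : i \in s -> ord_exps i.1.2 /\ (i.2 < n)%N.
  by move/(allP Ps); rewrite /mon_index /ord_exps => /and3P[-> ->].
have u0 i : i \in s -> u i 0%N = i.2.
  move=> si; have [ti _] := sP i si.
  by rewrite /u !cmM cmU upowE Nk0 (uprod0 ti).
have e0 : e 0%N = xx 0 by [].
refine (act_indep H_lin H_J e0 H_e (F := F) (f := xx N) (u := u) us _ _ _ _ sum0).
- by move=> i; rewrite /F pi_n_monomial pi_n_prod_omega.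
- move=> i _; rewrite (act_monomial H_lin e0 H_e).
  rewrite /u !monM mon_upow mon_uprod; congr (_ * _ * _).
  exact: iter_shift_der.
- by move=> i si; rewrite u0 //; case: (sP i si).
- move=> i i' si si' eu.
  have ej : i.2 = i'.2 by rewrite -(u0 i si) eu u0.
  have ea : i.1.1 = i'.1.1.
    have : u i (N + i.1.1)%N = u i' (N + i.1.1)%N by rewrite eu.
    rewrite /u !cmM !Nt // !cmU !upowE !N0k.
    by rewrite eqxx eqn_add2l; case: eqVneq.
  have et : i.1.2 = i'.1.2.
    apply: uprod_inj; [by case: (sP i si) | by case: (sP i' si')|].
    apply/eqP/cmP => k; have : u i k = u i' k by rewrite eu.
    by rewrite /u !cmM ej ea => /addIn /addnI.
  by case: i i' ej ea et {si si' eu} => [[a t] j] [[a' t'] j'] /= -> -> ->.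
Qed.
End Quotient.
End Model.

(** * The two bases *)

Section Bases.
Variables (K : fieldType) (n : nat).
Local Notation M := {cmonom nat}.

Let mono (u : M) : {malg K[M]} := << u >>.
Let mono_ext (V : lmodType K) (F : M -> V) : {linear {malg K[M]} -> V} := linext F.

Fact monoM u v : mono (mmul u v) = mono u * mono v.
Proof. by rewrite /mono malgUM. Qed.

Fact mono1 : mono mone = 1. Proof. by []. Qed.

Fact mono_extE (V : lmodType K) (F : M -> V) u : mono_ext F (mono u) = F u.
Proof. exact: etrans (linextU F 1 u) (scale1r _). Qed.

Lemma Tn_hg_indep : lin_indep (fun i : nat * nat => (i.2 < n)%N)
  (fun i => hn K n ^+ i.1 * gn K n ^+ i.2).
Proof. exact: (hg_indep (ext := mono_ext) monoM mono1 (@malg_lin_ind K M) mono_extE). Qed.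

Lemma Tn_mon_indep : (n%:R : K) = 0 -> lin_indep (mon_index n) (@mon K n).
Proof. exact: (mon_indep (ext := mono_ext) monoM mono1 (@malg_lin_ind K M) mono_extE). Qed.

Hypothesis n_gt0 : (0 < n)%N.

Lemma Tn_commutative (E1 : En K n 1 = 0) (x y : Tn K n) : x * y = y * x.
Proof. exact: (ore_comm (@EnS K n) (@EnC K n) (@Tn_ind K n) E1). Qed.

Lemma Tn_hg_basis (E1 : En K n 1 = 0) :
  is_basis (fun i : nat * nat => (i.2 < n)%N)
           (fun i => hn K n ^+ i.1 * gn K n ^+ i.2).
Proof.
split; first exact: Tn_hg_indep.
exact: (hg_spanning n_gt0 (@EnS K n) (@EnC K n) (gn_expn K n) (@Tn_ind K n) E1).
Qed.

Lemma Tn_mon_basis : (n%:R : K) = 0 -> is_basis (mon_index n) (@mon K n).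
Proof.
move=> n0; split; first exact: Tn_mon_indep.
exact: (mon_spanning n_gt0 (@EnS K n) (@EnC K n) (gn_expn K n) (@Tn_ind K n)).
Qed.
End Bases.

(** * Convolution on the free bialgebra *)

Section AntiMorphism.
Variables (K : fieldType) (A : algType K) (y : bool -> A).

(** The antimorphism of algebras with prescribed values on the letters. *)
Definition anti (z : FA K) : A :=
  linext (fun w : {fmonom bool} => \prod_(a <- rev w) y a) z.

Lemma anti_linear : linear anti.
Proof. by move=> c u v; rewrite /anti linearP. Qed.

Lemma anti_wd s : anti (wd K s) = \prod_(a <- rev s) y a.
Proof.
have -> : wd K s = << (FMonom s : {fmonom bool}) >> by rewrite wdE.
by rewrite /anti linextU scale1r.
Qed.

Lemma antiM u v : anti (u * v) = anti v * anti u.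
Proof.
move: u; apply: FA_ext => [c u1 u2|c u1 u2|s].
- by rewrite (FA_mulZDl c u1 u2 v) anti_linear.
- by rewrite (anti_linear c u1 u2) mulrDr scalerAr.
move: v; apply: FA_ext => [c v1 v2|c v1 v2|t].
- by rewrite (FA_mulZDr c v1 v2) anti_linear.
- by rewrite (anti_linear c v1 v2) mulrDl scalerAl.
by rewrite -wd_cat !anti_wd rev_cat big_cat.
Qed.

Lemma anti1 : anti 1 = 1.
Proof. by rewrite -wd_nil anti_wd big_nil. Qed.

Lemma anti_letter a : anti (letter K a) = y a.
Proof. by rewrite -wd_letter anti_wd big_seq1. Qed.

Lemma antiB u v : anti (u - v) = anti u - anti v.
Proof. by rewrite addrC -scaleN1r anti_linear scaleN1r addrC. Qed.

Lemma anti_bracket u v : anti (bracket u v) = bracket (anti v) (anti u).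
Proof.
apply: etrans (antiB (u * v) (v * u)) _.
by congr (_ - _); apply: antiM.
Qed.

Lemma antiX u m : anti (u ^+ m) = anti u ^+ m.
Proof.
elim: m => [|m IH]; first by rewrite !expr0 anti1.
by rewrite exprSr (antiM (u ^+ m)) IH -exprS.
Qed.
End AntiMorphism.

Section Convolution.
Variable K : fieldType.
Local Notation W := {fmonom bool}.

Definition word_pair (s t : word) : (W * W)%type := (FMonom s, FMonom t).

Definition tens_word (s t : word) : FA2 K := << word_pair s t >>.

Lemma tens_wordM s t s' t' :
  tens_word s t * tens_word s' t' = tens_word (s ++ s') (t ++ t').
Proof.
apply: etrans (malgUM K (word_pair s t) (word_pair s' t')) _; rewrite /tens_word; congr << _ >>.
by rewrite /word_pair -[mmul _ _]/(pair_mul _ _) /pair_mul /= /mmul /= !fmmulE.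
Qed.

Lemma tens_wordMA s t s' t' (z : FA2 K) :
  tens_word s t * (tens_word s' t' * z) = tens_word (s ++ s') (t ++ t') * z.
Proof. by rewrite -tens_wordM; apply: mulrA. Qed.

Lemma FA2_1 : 1 = tens_word [::] [::] :> FA2 K.
Proof.
rewrite -[LHS]/(<< (fmone bool, fmone bool) >>); rewrite /tens_word; congr << _ >>.
by rewrite /word_pair fmoneE.
Qed.

Lemma tens_wordE s t : tens (wd K s) (wd K t) = tens_word s t.
Proof.
have e u : wd K u = << (FMonom u : W) >> by rewrite wdE.
by rewrite !e /tens !msuppU1 !big_seq_fset1 !mcoeffUU mulr1.
Qed.

Lemma coprod_g : coprod_letter K lg = tens_word [:: lg] [:: lg].
Proof. by rewrite -tens_wordE !wd_letter. Qed.

Lemma coprod_h : coprod_letter K lh =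
  tens_word [::] [:: lh] + tens_word [:: lh] [:: lg].
Proof. by rewrite -!tens_wordE !wd_letter wd_nil. Qed.

Definition coprod_word (s : word) : FA2 K := \prod_(a <- s) coprod_letter K a.

Lemma coprod_wd s : coprod (wd K s) = coprod_word s.
Proof.
have -> : wd K s = << (FMonom s : W) >> by rewrite wdE.
rewrite -[LHS]/(linext (fun w : W => coprod_word w) _).
by rewrite linextU scale1r.
Qed.

Lemma coprod_linear : linear (@coprod K).
Proof.
move=> c u v; rewrite -![coprod _]/(linext (fun w : W => coprod_word w) _).
exact: linearP.
Qed.

Lemma counit_wd s : counit (wd K s) = (lh \notin s)%:R.
Proof.
have -> : wd K s = << (FMonom s : W) >> by rewrite wdE.
rewrite /counit mmapU /= mul1r /counit_word /=.
elim: s => [|a s IH]; first by rewrite big_nil.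
by rewrite big_cons IH inE; case: a; rewrite /counit_letter /= ?mul0r ?mul1r.
Qed.

Lemma coprod_word_rcons s a :
  coprod_word (rcons s a) = coprod_word s * coprod_letter K a.
Proof. by rewrite /coprod_word -cats1 big_cat big_seq1. Qed.

Lemma coprod_word_cons s a :
  coprod_word (a :: s) = coprod_letter K a * coprod_word s.
Proof. exact: big_cons. Qed.

Lemma coprod_rcons_h s : coprod_word (rcons s lh) =
  coprod_word s * tens_word [::] [:: lh] + coprod_word s * tens_word [:: lh] [:: lg].
Proof. by rewrite coprod_word_rcons coprod_h mulrDr. Qed.

Lemma coprod_rcons_g s :
  coprod_word (rcons s lg) = coprod_word s * tens_word [:: lg] [:: lg].
Proof. by rewrite coprod_word_rcons coprod_g. Qed.

Lemma coprod_cons_h s : coprod_word (lh :: s) =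
  tens_word [::] [:: lh] * coprod_word s + tens_word [:: lh] [:: lg] * coprod_word s.
Proof. by rewrite coprod_word_cons coprod_h mulrDl. Qed.

Lemma coprod_cons_g s :
  coprod_word (lg :: s) = tens_word [:: lg] [:: lg] * coprod_word s.
Proof. by rewrite coprod_word_cons coprod_g. Qed.

Lemma coprod_word_nil : coprod_word [::] = tens_word [::] [::].
Proof. by rewrite /coprod_word big_nil FA2_1. Qed.

Lemma tw_coprod_h s t w : tens_word s t * coprod_word (lh :: w) =
  tens_word (s ++ [::]) (t ++ [:: lh]) * coprod_word w +
  tens_word (s ++ [:: lh]) (t ++ [:: lg]) * coprod_word w.
Proof.
rewrite coprod_cons_h; apply: etrans (mulrDr _ _ _) _.
by apply: congr2; apply: tens_wordMA.
Qed.

Lemma tw_coprod_g s t w : tens_word s t * coprod_word (lg :: w) =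
  tens_word (s ++ [:: lg]) (t ++ [:: lg]) * coprod_word w.
Proof. by rewrite coprod_cons_g; apply: tens_wordMA. Qed.

Section Conv.
Variables (A : algType K) (f f' : FA K -> A).

(** [m o (f (x) f')]. *)
Definition conv (z : FA2 K) : A :=
  linext (fun p : W * W => f << p.1 >> * f' << p.2 >>) z.

Lemma conv_linear : linear conv.
Proof. by move=> c u v; rewrite /conv linearP. Qed.

Lemma convU s t : conv (tens_word s t) = f (wd K s) * f' (wd K t).
Proof. by rewrite /conv linextU scale1r /= !wdE. Qed.

Lemma convD (u v : FA2 K) : conv (u + v) = conv u + conv v.
Proof. by have := conv_linear 1 u v; rewrite !scale1r. Qed.

Lemma conv_coprod_linear : linear (fun x => conv (coprod x)).
Proof. by move=> c x y; rewrite coprod_linear conv_linear. Qed.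

Lemma FA2_mulZDl (c : K) (x y z : FA2 K) : (c *: x + y) * z = c *: (x * z) + y * z.
Proof. by rewrite mulrDl scalerAl. Qed.

Lemma FA2_mulZDr (c : K) (x y z : FA2 K) : z * (c *: x + y) = c *: (z * x) + z * y.
Proof. by rewrite mulrDr; congr (_ + _); apply/esym/malg_scalerAr. Qed.

(** A factor on the right of the argument wraps around when [f] reverses and
    [f'] preserves products, a factor on the left in the opposite case. *)
Lemma conv_mulr (z : FA2 K) s t :
  (forall u v, f (u * v) = f v * f u) -> (forall u v, f' (u * v) = f' u * f' v) ->
  conv (z * tens_word s t) = f (wd K s) * conv z * f' (wd K t).
Proof.
move=> fM f'M; move: z; apply: malg_lin_ext => [c u v|c u v|k].
- by rewrite (FA2_mulZDl c u v) conv_linear.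
- by rewrite (conv_linear c u v) mulrDr mulrDl -scalerAr -scalerAl.
case: k => [[u] [v]]; rewrite -[<< _ >>]/(tens_word u v) (tens_wordM u v s t).
apply: etrans (convU (u ++ s) (v ++ t)) _.
by rewrite convU !wd_cat (fM (wd K u)) (f'M (wd K v)) !mulrA.
Qed.

Lemma conv_mull (z : FA2 K) s t :
  (forall u v, f (u * v) = f u * f v) -> (forall u v, f' (u * v) = f' v * f' u) ->
  conv (tens_word s t * z) = f (wd K s) * conv z * f' (wd K t).
Proof.
move=> fM f'M; move: z; apply: malg_lin_ext => [c u v|c u v|k].
- by rewrite (FA2_mulZDr c u v) conv_linear.
- by rewrite (conv_linear c u v) mulrDr mulrDl -scalerAr -scalerAl.
case: k => [[u] [v]]; rewrite -[<< _ >>]/(tens_word u v) (tens_wordM s t u v).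
apply: etrans (convU (s ++ u) (t ++ v)) _.
by rewrite convU !wd_cat (fM (wd K s)) (f'M (wd K t)) !mulrA.
Qed.
End Conv.

Lemma conv_ext (A : algType K) (f1 f2 f1' f2' : FA K -> A) z :
  f1 =1 f2 -> f1' =1 f2' -> conv f1 f1' z = conv f2 f2' z.
Proof. by move=> e e'; apply: eq_bigr => p _; rewrite e e'. Qed.

Lemma convBr (A : algType K) (f f1 f2 : FA K -> A) z :
  conv f (fun x => f1 x - f2 x) z = conv f f1 z - conv f f2 z.
Proof.
rewrite /conv /linext -sumrB; apply: eq_bigr => p _.
by rewrite mulrBr scalerBr.
Qed.
End Convolution.

(** * The antipode *)

Section OreAntipode.
Variables (K : fieldType) (A : algType K) (x_ : nat -> A) (h : A) (n : nat).
Hypothesis n_gt0 : (0 < n)%N.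
Hypothesis xS : forall k, x_ k.+1 = bracket (x_ k) h.
Hypothesis xC : forall a b, x_ a * x_ b = x_ b * x_ a.
Hypothesis x0n : x_ 0 ^+ n = 1.
Variable rho : FA K -> A.
Hypothesis rhoM : forall u v, rho (u * v) = rho u * rho v.
Hypothesis rho1 : rho 1 = 1.
Hypothesis rhog : rho (letter K lg) = x_ 0.
Hypothesis rhoh : rho (letter K lh) = h.
Local Notation g := (x_ 0).

Definition ginv : A := g ^+ n.-1.

Lemma mulgV : g * ginv = 1. Proof. by rewrite /ginv -exprS prednK. Qed.
Lemma mulVg : ginv * g = 1. Proof. by rewrite /ginv -exprSr prednK. Qed.

Lemma Ealg_ginv : Ealg x_ ginv.
Proof. exact/Ealg_exp/Ealg_gen. Qed.

Definition anti_letters (a : bool) : A := if a then - (h * ginv) else ginv.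
Definition antiS : FA K -> A := anti anti_letters.

(** [antiS] sends [E_(omega_k)] into the commutative subalgebra generated by the
    [x_ k]: if [antiS x = y] lies there, then [antiS [x, h] = [y, h] * g^-1]. *)
Lemma antiS_omega k : Ealg x_ (antiS (E K (omega k))).
Proof.
elim: k => [|k IH]; first by rewrite E_omega0 /antiS anti_letter; apply: Ealg_ginv.
rewrite E_omegaS /antiS anti_bracket anti_letter -/antiS /anti_letters.
move: IH; rewrite /antiS; move: (anti _ _) => y hy.
have -> : bracket (- (h * ginv)) y = bracket y h * ginv.
  rewrite /bracket mulNr mulrN opprK mulrBl addrC -!mulrA; congr (_ - h * _).
  exact: Ealg_comm Ealg_ginv hy.
by apply: EalgM Ealg_ginv; apply: Ealg_bracket.
Qed.

Lemma antiS_ker z : ideal_gen (@Tn_rels K n) z -> antiS z = 0.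
Proof.
elim=> [|a r b y hr _ IH].
  exact/linear_at0/anti_linear.
have : antiS r = 0.
  case: hr => [[k [l ->]]|->].
    apply: etrans (anti_bracket _ _ _) _; apply/eqP; rewrite subr_eq0; apply/eqP.
    by apply: (Ealg_comm xC); apply: antiS_omega.
  apply: etrans (antiB _ _ _) _; rewrite anti1 antiX anti_letter /= /ginv.
  by rewrite -exprM mulnC exprM x0n expr1n subrr.
have := anti_linear anti_letters 1 (a * r * b) y; rewrite !scale1r -/antiS IH addr0 => ->.
by rewrite /antiS (antiM _ (a * r)) (antiM _ a) => ->; rewrite mul0r mulr0.
Qed.

Lemma antiS1 : antiS 1 = 1. Proof. exact: anti1. Qed.

(* Unequal arguments of these functions would otherwise be compared by unfolding
   the monoid algebra. *)
Local Opaque wd tens_word coprod_word conv antiS.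

Lemma antiS_convl x : conv antiS rho (coprod x) = (counit x)%:A.
Proof.
move: x; apply: FA_ext => [|c x y|s]; first exact: conv_coprod_linear.
  by rewrite /counit mmapD mmapZ scalerDl scalerA.
rewrite coprod_wd counit_wd.
elim/last_ind: s => [|t a IH].
  by rewrite coprod_word_nil convU wd_nil rho1 antiS1 mulr1 scale1r.
have convM s1 s2 : conv antiS rho (coprod_word K t * tens_word K s1 s2) =
    antiS (wd K s1) * conv antiS rho (coprod_word K t) * rho (wd K s2).
  by apply: conv_mulr => //; apply: antiM.
have antiSw b : antiS (wd K [:: b]) = anti_letters b by rewrite wd_letter; apply: anti_letter.
have rhow b : rho (wd K [:: b]) = rho (letter K b) by rewrite wd_letter.
have antiSn : antiS (wd K [::]) = 1 by rewrite wd_nil antiS1.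
rewrite mem_rcons inE negb_or; case: a => /=.
  rewrite coprod_rcons_h convD.
  apply: etrans (congr2 +%R (convM [::] [:: lh]) (convM [:: lh] [:: lg])) _.
  rewrite IH !antiSw antiSn !rhow rhog rhoh /=.
  rewrite mul1r -scalerAl mul1r -scalerAr -scalerAl mulr1 mulNr -mulrA mulVg mulr1.
  by rewrite scalerN subrr scale0r.
rewrite coprod_rcons_g; apply: etrans (convM [:: lg] [:: lg]) _.
rewrite IH antiSw rhow rhog /=.
by rewrite -scalerAr -scalerAl mulr1 mulVg.
Qed.

Lemma antiS_convr x : conv rho antiS (coprod x) = (counit x)%:A.
Proof.
move: x; apply: FA_ext => [|c x y|s]; first exact: conv_coprod_linear.
  by rewrite /counit mmapD mmapZ scalerDl scalerA.
rewrite coprod_wd counit_wd; elim: s => [|a t IH].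
  by rewrite coprod_word_nil convU wd_nil rho1 antiS1 mulr1 scale1r.
have convM s1 s2 : conv rho antiS (tens_word K s1 s2 * coprod_word K t) =
    rho (wd K s1) * conv rho antiS (coprod_word K t) * antiS (wd K s2).
  by apply: conv_mull => //; apply: antiM.
have antiSw b : antiS (wd K [:: b]) = anti_letters b by rewrite wd_letter; apply: anti_letter.
have rhow b : rho (wd K [:: b]) = rho (letter K b) by rewrite wd_letter.
have rhon : rho (wd K [::]) = 1 by rewrite wd_nil.
rewrite inE negb_or; case: a => /=.
  rewrite coprod_cons_h convD.
  apply: etrans (congr2 +%R (convM [::] [:: lh]) (convM [:: lh] [:: lg])) _.
  rewrite IH !antiSw rhon !rhow rhoh /=.
  rewrite mul1r -scalerAl mul1r -scalerAr -scalerAl mulr1 scalerN addNr.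
  by rewrite scale0r.
rewrite coprod_cons_g; apply: etrans (convM [:: lg] [:: lg]) _.
rewrite IH antiSw rhow rhog /=.
by rewrite -scalerAr -scalerAl mulr1 mulgV.
Qed.

(** Uniqueness of a right convolution inverse of [rho]: in [coprod w] the term
    with the most letters [h] on the right is [g^a (x) w], where [a] is the number
    of letters [g] in [w]; as [g] is invertible, [D w] is determined by the values
    of [D] at words with fewer letters [h]. *)
Lemma conv_right_inj (D : FA K -> A) : linear D ->
  (forall x, conv rho D (coprod x) = 0) -> forall x, D x = 0.
Proof.
move=> DL D0; have D00 : D 0 = 0 := linear_at0 DL.
have lead m : (forall v, (count_mem lh v < m)%N -> D (wd K v) = 0) ->
    forall w u v, (count_mem lh (v ++ w) <= m)%N ->
    conv rho D (tens_word K u v * coprod_word K w) =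
    rho (wd K u) * g ^+ count_mem lg w * D (wd K (v ++ w)).
  move=> Dm; elim=> [|a w IH] u v c.
    by rewrite coprod_word_nil -FA2_1 mulr1 convU cats0 mulr1.
  case: a c => c.
    have c1 : (count_mem lh ((v ++ [:: lh]) ++ w) <= m)%N by rewrite -catA.
    have c2 : (count_mem lh ((v ++ [:: lg]) ++ w) < m)%N.
      by move: c; rewrite !count_cat /=; lia.
    rewrite tw_coprod_h convD.
    apply: etrans (congr2 +%R (IH _ _ c1) (IH _ _ (ltnW c2))) _.
    by rewrite (Dm _ c2) mulr0 addr0 cats0 -catA /= add0n.
  have c1 : (count_mem lh ((v ++ [:: lg]) ++ w) <= m)%N by rewrite -catA.
  rewrite tw_coprod_g.
  apply: etrans (IH _ _ c1) _; rewrite -catA /=.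
  by rewrite wd_cat rhoM wd_letter rhog -(mulrA _ g) -exprS.
have Dw m : forall w, (count_mem lh w < m)%N -> D (wd K w) = 0.
  elim: m => // m IH w; rewrite ltnS => c.
  have := lead m IH w [::] [::] c.
  rewrite -FA2_1 mul1r -coprod_wd D0 wd_nil rho1 mul1r => e.
  have : ginv ^+ count_mem lg w * (g ^+ count_mem lg w * D (wd K w)) = 0 by rewrite -e mulr0.
  rewrite mulrA -exprMn_comm ?mulVg ?expr1n ?mul1r //.
  by rewrite /GRing.comm mulVg mulgV.
elim/FA_ind=> [|c s x IH]; first exact: D00.
by rewrite DL IH (Dw (count_mem lh s).+1) // scaler0 addr0.
Qed.

Variable p : nat.
Hypothesis p0 : (p%:R : K) = 0.
Hypothesis A_ind : forall P : A -> Prop, P 0 ->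
  (forall c (s : word) y, P y ->
     P (c *: (\prod_(a <- s) (if a then h else x_ 0)) + y)) ->
  forall y, P y.

Lemma bracket_gX m : g ^+ m * h - h * g ^+ m = (g ^+ m.-1 * x_ 1) *+ m.
Proof.
elim: m => [|m IH]; first by rewrite mul1r mulr1 subrr.
have -> : g ^+ m.+1 * h - h * g ^+ m.+1 =
    g ^+ m * (g * h - h * g) + (g ^+ m * h - h * g ^+ m) * g.
  by rewrite exprSr mulrBr mulrBl !mulrA subrKA.
rewrite IH -[g * h - _]xS mulrS mulrnAl -mulrA (xC 1 0) mulrA -exprSr.
by case: m {IH} => [|m].
Qed.

(** [[g^p, h] = p g^(p-1) x_1]. *)
Lemma gXp_central y : g ^+ p * y = y * g ^+ p.
Proof.
have gh : g ^+ p * h = h * g ^+ p.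
  by apply/eqP; rewrite -subr_eq0 bracket_gX -scaler_nat p0 scale0r.
elim/A_ind: y => [|c s y IH]; first by rewrite mulr0 mul0r.
rewrite mulrDl mulrDr IH -scalerAr -scalerAl; congr (_ *: _ + _).
elim: s => [|b s IHs]; first by rewrite big_nil mulr1 mul1r.
have gb : g ^+ p * (if b then h else g) = (if b then h else g) * g ^+ p.
  by case: b => //; rewrite -exprSr exprS.
by rewrite !big_cons mulrA gb -mulrA IHs mulrA.
Qed.

(** An antimorphism with the values of the antipode has conjugation by [g] as
    its square, and [g^p] is central in characteristic [p]. *)
Lemma antipode_order (S : A -> A) : linear S ->
  (forall u v, S (u * v) = S v * S u) -> S 1 = 1 ->
  S g = ginv -> S h = - (h * ginv) -> forall y, iter (2 * p) S y = y.
Proof.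
move=> SL SM S1 Sg Sh.
have Sgi : S ginv = g.
  have e : S ginv * ginv = 1 by rewrite -[X in _ * X]Sg -SM mulgV S1.
  by rewrite -[LHS]mulr1 -mulVg mulrA e mul1r.
have Szero : S 0 = 0 := linear_at0 SL.
have SN u : S (- u) = - S u.
  by have := SL (-1) u 0; rewrite Szero !addr0 !scaleN1r.
have SS y : S (S y) = g * y * ginv.
  elim/A_ind: y => [|c s y IH]; first by rewrite !Szero mulr0 mul0r.
  rewrite !SL IH mulrDr mulrDl -scalerAr -scalerAl; congr (_ *: _ + _).
  elim: s => [|b s IHs]; first by rewrite big_nil !S1 mulr1 mulgV.
  have Sb : S (S (if b then h else g)) = g * (if b then h else g) * ginv.
    case: b; last by rewrite Sg Sgi -mulrA mulgV mulr1.
    by rewrite Sh SN SM Sgi Sh mulrN opprK mulrA.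
  rewrite big_cons !SM IHs Sb !mulrA; congr (_ * _ * _).
  by rewrite -(mulrA _ ginv g) mulVg mulr1.
move=> y; have iterS2 m : iter (2 * m) S y = g ^+ m * y * ginv ^+ m.
  elim: m => [|m IH]; first by rewrite mul1r mulr1.
  by rewrite mulnS !iterS IH SS exprS exprSr !mulrA.
rewrite iterS2 gXp_central -mulrA -exprMn_comm ?mulgV ?expr1n ?mulr1 //.
by rewrite /GRing.comm mulVg mulgV.
Qed.
End OreAntipode.

Section TnAntipode.
Variables (K : fieldType) (n : nat).
Hypothesis n_gt0 : (0 < n)%N.
Local Notation T := (Tn K n).

Let antiT : FA K -> T := antiS (En K n) (hn K n) n.
Let rhoL : linear (pi_n n : FA K -> T). Proof. exact: linearP. Qed.
Let rhoM (u v : FA K) : pi_n n (u * v) = pi_n n u * pi_n n v.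
Proof. exact: (rmorphM (pi_n n)). Qed.
Let rho1 : pi_n n (1 : FA K) = 1. Proof. exact: (rmorph1 (pi_n n)). Qed.
Let antiTL : linear antiT. Proof. exact: anti_linear. Qed.

Definition Tn_lift (y : T) : FA K := sval (cid (pi_n_surj y)).

Lemma Tn_liftK y : pi_n n (Tn_lift y) = y.
Proof. exact: (svalP (cid (pi_n_surj y))). Qed.

(** Well defined on classes by [antipode_pi], since the antimorphism kills the
    relations. *)
Definition antipode_fun (y : T) : T := antiT (Tn_lift y).

Lemma antipode_pi z : antipode_fun (pi_n n z) = antiT z.
Proof.
have e : pi_n n (Tn_lift (pi_n n z) - z) = 0.
  by apply: etrans (raddfB (pi_n n) _ _) _; apply/eqP; rewrite subr_eq0; apply/eqP/Tn_liftK.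
have := antiS_ker (@EnS K n) (@EnC K n) (gn_expn K n) (pi_n_ker e).
by move=> h0; apply/eqP; rewrite -subr_eq0 -[_ - _](antiB _ _ _); apply/eqP.
Qed.

Lemma antipode_linear : linear antipode_fun.
Proof.
move=> c y z; have e : c *: y + z = pi_n n (c *: Tn_lift y + Tn_lift z).
  by rewrite rhoL !Tn_liftK.
apply: etrans (congr1 antipode_fun e) _; apply: etrans (antipode_pi _) _.
exact: antiTL.
Qed.

Lemma Tn_convl x : conv antiT (pi_n n) (coprod x) = (counit x)%:A.
Proof. exact: (antiS_convl n_gt0 (gn_expn K n) rhoM rho1 (erefl _) (erefl _)). Qed.

Lemma Tn_convr x : conv (pi_n n) antiT (coprod x) = (counit x)%:A.
Proof. exact: (antiS_convr n_gt0 (gn_expn K n) rhoM rho1 (erefl _) (erefl _)). Qed.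

Lemma Tn_antipode_exists : exists S : {linear T -> T}, is_antipode S.
Proof.
pose L := GRing.isLinear.Build K T T *:%R antipode_fun antipode_linear.
pose S : {linear T -> T} := HB.pack antipode_fun L.
have SE z : S (pi_n n z) = antiT z by exact: antipode_pi.
exists S => x; split.
  by apply: etrans (Tn_convl x); apply: (conv_ext (f1 := S \o pi_n n)).
by apply: etrans (Tn_convr x); apply: (conv_ext (f1' := S \o pi_n n)).
Qed.

Lemma antipode_unique (S : {linear T -> T}) :
  is_antipode S -> forall z, S (pi_n n z) = antiT z.
Proof.
move=> hS z; pose D (x : FA K) := S (pi_n n x) - antiT x.
have DL : linear D.
  move=> c x y; rewrite /D rhoL linearP antiTL scalerBr opprD addrACA //.
suff D0 : D z = 0 by apply/eqP; rewrite -subr_eq0; apply/eqP.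
apply: (conv_right_inj (x_ := En K n) n_gt0 (gn_expn K n) rhoM rho1 (erefl _) DL) => x.
apply: etrans (convBr (pi_n n) (S \o pi_n n) antiT (coprod x)) _.
by rewrite Tn_convr; apply/eqP; rewrite subr_eq0; apply/eqP; apply: (hS x).2.
Qed.

Lemma Tn_antipode_order (p : nat) (S : {linear T -> T}) : (p%:R : K) = 0 ->
  is_antipode S -> forall x, iter (2 * p) S x = x.
Proof.
move=> p0 /antipode_unique SE.
apply: (antipode_order n_gt0 (@EnS K n) (@EnC K n) (gn_expn K n) p0 (@Tn_ind K n)).
- exact: linearP.
- move=> u v; have [u' <-] := pi_n_surj u; have [v' <-] := pi_n_surj v.
  by rewrite -rhoM !SE; apply: antiM.
- by rewrite -rho1 SE; apply: anti1.
- by apply: etrans (SE _) _; apply: anti_letter.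
- by apply: etrans (SE _) _; apply: anti_letter.
Qed.
End TnAntipode.

(** * Gelfand-Kirillov dimension *)

Section Dimension.
Variables (K : fieldType) (V : lmodType K).

Lemma lin_indep_inj (I : eqType) (P : pred I) (F : I -> V) (i j : I) :
  lin_indep P F -> P i -> P j -> F i = F j -> i = j.
Proof.
move=> FI Pi Pj e; apply/eqP/negP => /negP ij.
have := FI [:: i; j] (fun k => if k == i then 1 else -1).
rewrite /= inE ij Pi Pj !big_cons big_nil eqxx eq_sym (negbTE ij) addr0.
rewrite e scale1r scaleN1r subrr => /(_ isT isT erefl i).
by rewrite inE !eqxx => /(_ isT) /eqP; rewrite oner_eq0.
Qed.

Lemma lin_indep_comp (I I' : eqType) (P : pred I) (P' : pred I') (F : I -> V)
    (f : I' -> I) :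
  lin_indep P F -> injective f -> (forall i, P' i -> P (f i)) ->
  lin_indep P' (F \o f).
Proof.
move=> FI fI Pf s c us Ps sum0 i si.
pose c' p := \sum_(j <- s | f j == p) c j.
have c'f j : j \in s -> c' (f j) = c j.
  move=> sj; rewrite /c' big_mkcond (bigD1_seq j) //= eqxx big1 ?addr0 // => k kj.
  by case: eqP => // /fI e; rewrite e eqxx in kj.
rewrite -(c'f i si); apply: (FI (map f s) c'); rewrite ?map_inj_uniq //.
- by apply/allP => _ /mapP[j sj ->]; apply/Pf/(allP Ps).
- rewrite -[RHS]sum0 big_map big_seq_cond [RHS]big_seq_cond.
  by apply: eq_bigr => j /andP[sj _]; rewrite c'f.
by rewrite map_f.
Qed.

Lemma span_dim_ge (I : finType) (F : I -> V) (s : seq V) :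
  lin_indep predT F -> (forall i, F i \in s) -> (#|I| <= span_dim s)%N.
Proof.
move=> FI Fs; have ltF i : (index (F i) s < size s)%N by rewrite index_mem.
pose idx i := Ordinal (ltF i).
have sidx i : s`_(idx i) = F i by rewrite /= nth_index.
have idxI : injective idx.
  move=> i j e; apply: (lin_indep_inj FI) => //.
  by rewrite -(sidx i) -(sidx j) e.
pose J := [set idx i | i in I].
have -> : #|I| = #|J| by rewrite card_imset.
apply: (leq_bigmax_cond J); apply/asboolP => t c ut tJ sum0.
pose u := [seq i <- enum I | idx i \in t].
have tu : perm_eq t (map idx u).
  apply: uniq_perm => //; first by rewrite map_inj_uniq // filter_uniq // enum_uniq.
  move=> j; apply/idP/mapP => [tj|[i]]; last by rewrite mem_filter => /andP[ti _] ->.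
  have /imsetP[i _ e] := allP tJ j tj; exists i => //.
  by rewrite mem_filter -e tj mem_enum.
move=> j; rewrite (perm_mem tu) => /mapP[i ui ->].
apply: (FI u (c \o idx)) => //; first by rewrite filter_uniq // enum_uniq.
  exact/allP.
rewrite -[RHS]sum0 (perm_big _ tu) big_map.
by apply: eq_bigr => k _; rewrite sidx.
Qed.
End Dimension.

Lemma products_prod (A : nzRingType) (s l : seq A) m :
  all (mem s) l -> (size l <= m)%N -> \prod_(x <- l) x \in products s m.
Proof.
elim: m l => [|m IH] [|x l] //= al sl; rewrite ?big_nil ?mem_head //.
case/andP: al => xs al; rewrite big_cons inE; apply/orP; right.
by apply/allpairsP; exists (x, \prod_(y <- l) y); split=> //=; apply: IH.
Qed.

Section PolynomialGrowth.
Variables (R : realType).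

Lemma limn_esup_ge (u : nat -> \bar R) (l : \bar R) (m0 : nat) :
  (forall m, (m0 <= m)%N -> (l <= u m)%E) -> (l <= limn_esup u)%E.
Proof.
move=> ul; rewrite /limn_esup /limf_esup; apply: le_ereal_inf_tmp => _ [V [k _ Vk] <-].
apply: le_trans (ul (maxn m0 k) (leq_maxl _ _)) _.
apply: ereal_sup_ubound; exists (maxn m0 k) => //.
by apply: Vk => /=; rewrite leq_maxr.
Qed.

Lemma GKdim_infinite (K : fieldType) (A : lalgType K) :
  (forall L, exists s : seq A, exists m0, forall m, (m0 <= m)%N ->
     (m ^ L <= span_dim (products s m))%N) ->
  GKdim R A = +oo%E.
Proof.
move=> growth; apply: eq_infty => r.
have [L rL] : exists L : nat, r <= L%:R.
  exists (Num.truncn `|r|).+1; apply: le_trans (ler_norm r) _.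
  exact/ltW/truncnS_gt.
have [s [m0 sm]] := growth L.
apply: le_trans (ereal_sup_ubound _); last by exists s.
apply: (limn_esup_ge (m0 := maxn m0 2)) => m; rewrite geq_max => /andP[m0m m2].
have m1 : 1 < m%:R :> R by rewrite ltr1n.
rewrite lee_fin; apply: le_trans rL _; rewrite ler_pdivlMr ?ln_gt0 //.
have m0' : 0 < m%:R :> R by apply: lt_trans m1.
rewrite mulr_natl -lnXn // -natrX ler_ln ?ler_nat ?sm // qualifE /= ltr0n.
  by rewrite expn_gt0; lia.
by apply: leq_trans (sm _ m0m); rewrite expn_gt0; lia.
Qed.
End PolynomialGrowth.

(** From [(2L)^2 <= m < (q+1) 2L] one gets [2L < q+1] and [m <= (q+1)^2], where
    [q] is the quotient: the exponent [2L] instead of [L] absorbs the division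
    by [2L]. *)
Lemma expn_divn_growth L m : ((2 * L) ^ 2 <= m)%N -> (0 < L)%N ->
  (m ^ L <= (m %/ (2 * L)).+1 ^ (2 * L))%N.
Proof.
move=> mL L0; rewrite expnM leq_exp2r //.
have lt : (m < (m %/ (2 * L)).+1 * (2 * L))%N by rewrite ltn_ceil ?muln_gt0.
move: (m %/ _).+1 lt => q; nia.
Qed.

Section TnGrowth.
Variables (K : fieldType) (n : nat).
Hypothesis n_gt0 : (0 < n)%N.
Hypothesis n0 : (n%:R : K) = 0.
Variables N M : nat.

(** Keys decrease and zero exponents are dropped, as [mon_index] requires. *)
Definition exps_of (a : N.-tuple 'I_M.+1) : seq (nat * nat) :=
  [seq (k, nat_of_ord (nth ord0 a k.-1)) | k <- rev (iota 1 N) & (0 < nth ord0 a k.-1)%N].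

Definition index_of (a : N.-tuple 'I_M.+1) : nat * seq (nat * nat) * nat :=
  (0%N, exps_of a, 0%N).

Lemma exps_ofE a k m : (0 < m)%N -> (k < N)%N ->
  ((k.+1, m) \in exps_of a) = (nth ord0 a k == m :> nat).
Proof.
move=> m0 kN; apply/mapP/eqP => [[j _ [<- ->]] //|e].
by exists k.+1; rewrite /= ?e // mem_filter /= e m0 mem_rev mem_iota /=.
Qed.

Lemma index_of_inj : injective index_of.
Proof.
move=> a b [e]; apply: val_inj; apply: (@eq_from_nth _ ord0); rewrite !size_tuple // => k kN.
apply: val_inj; rewrite [LHS]/= [RHS]/=.
have [a0|a0] := posnP (nth ord0 a k).
  have [b0|b0] := posnP (nth ord0 b k); first by rewrite a0 b0.
  by have := exps_ofE b b0 kN; rewrite eqxx -e exps_ofE // => /eqP.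
by have := exps_ofE a a0 kN; rewrite eqxx e exps_ofE // => /eqP.
Qed.

Lemma index_ofP a : mon_index n (index_of a).
Proof.
rewrite /mon_index /= n_gt0 andbT; apply/andP; split.
  rewrite /exps_of -map_comp map_id_in //; apply: sorted_filter.
    by move=> x y z /= h1 h2; apply: ltn_trans h2 h1.
  by rewrite rev_sorted; apply: iota_ltn_sorted.
apply/allP => q /mapP[k]; rewrite mem_filter mem_rev mem_iota.
by move=> /andP[k0 /andP[k1 _]] ->; rewrite /= k1.
Qed.

Definition gk_gens : seq (Tn K n) := [seq En K n k | k <- iota 1 N].

Lemma mon_products m a : (N * M <= m)%N ->
  mon K n (index_of a) \in products gk_gens m.
Proof.
move=> NM; rewrite /mon /= !expr0 mul1r mulr1 /mon_E.
pose l := flatten [seq nseq q.2 (En K n q.1) | q <- exps_of a].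
have -> : \prod_(q <- exps_of a) En K n q.1 ^+ q.2 = \prod_(x <- l) x.
  rewrite /l big_flatten big_map; apply: eq_bigr => q _.
  by rewrite big_nseq -Monoid.iteropE.
apply: products_prod.
  apply/allP => x /flatten_mapP[q qa]; rewrite mem_nseq => /andP[_ /eqP ->].
  apply: map_f; case/mapP: qa => k; rewrite mem_filter mem_rev => /andP[_ kN] -> //.
apply: leq_trans NM; rewrite size_flatten /shape -map_comp.
rewrite sumnE big_map; under eq_bigr do rewrite /= size_nseq.
apply: (@leq_trans (\sum_(q <- exps_of a) M)%N).
  rewrite big_seq_cond [leqRHS]big_seq_cond; apply: leq_sum => q /andP[/mapP[k _ ->] _] /=.
  by rewrite -ltnS.
rewrite big_const_seq count_predT iter_addn_0 mulnC leq_mul2r; apply/orP; right.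
by rewrite size_map size_filter (leq_trans (count_size _ _)) // size_rev size_iota.
Qed.

Lemma Tn_growth m : (N * M <= m)%N ->
  (M.+1 ^ N <= span_dim (products gk_gens m))%N.
Proof.
move=> NM; rewrite -[M.+1]card_ord -card_tuple.
apply: (@span_dim_ge _ _ _ (@mon K n \o index_of)) => [|a].
  apply: lin_indep_comp (Tn_mon_indep n0) index_of_inj _ => a _.
  exact: index_ofP.
exact: mon_products.
Qed.
End TnGrowth.

Lemma Tn_GKdim (R : realType) (K : fieldType) (n : nat) :
  (0 < n)%N -> (n%:R : K) = 0 -> GKdim R (Tn K n) = +oo%E.
Proof.
move=> n_gt0 n0; apply: GKdim_infinite => -[|L].
  exists [::], 0%N => m _; rewrite expn0.
  by have := @Tn_growth K n n_gt0 n0 0 0 m isT; rewrite expn0.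
exists (gk_gens K n (2 * L.+1)), ((2 * L.+1) ^ 2)%N => m hm.
apply: leq_trans (expn_divn_growth hm _) _ => //.
by apply: Tn_growth => //; rewrite mulnC leq_divM.
Qed.

Theorem lemma3p3 (R : realType) (K : fieldType) (n : nat) (n_ge2 : (2 <= n)%N) :
  (En K n 1 = 0 ->
     (forall x y : Tn K n, x * y = y * x) /\
     is_basis (fun i : nat * nat => (i.2 < n)%N)
              (fun i => hn K n ^+ i.1 * gn K n ^+ i.2)) /\
  (forall p : nat,
     En K n 1 <> 0 -> p \in [pchar K] -> (p %| n)%N ->
     [/\ GKdim R (Tn K n) = +oo%E,
         is_basis (mon_index n) (@mon K n),
         exists S : {linear Tn K n -> Tn K n}, is_antipode S &
         forall S : {linear Tn K n -> Tn K n},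
           is_antipode S -> forall x, iter (2 * p) S x = x]).
Proof.
have n_gt0 : (0 < n)%N by apply: ltnW.
split=> [E1|p _ pK pn].
  by split; [apply: Tn_commutative | apply: Tn_hg_basis].
have p0 : (p%:R : K) = 0 by apply: pcharf0.
have n0 : (n%:R : K) = 0 by apply/eqP; rewrite -(dvdn_pcharf pK).
split.
- exact: Tn_GKdim.
- exact: Tn_mon_basis.
- exact: Tn_antipode_exists.
by move=> S; apply: Tn_antipode_order.
Qed.
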